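(* Let $n\in\mathbb N\cup\{\infty\}$, let $k^i\ge 0$ ($1\le i\le n$) satisfy $\sum_i e^{-k^i}\le 1$, let $T\ge1$, and let $s_1,\dots,s_T\in[0,1]^n$ be a fixed sequence of loss vectors. The hierarchical algorithm $\widetilde{\rm FPL}$ (hierarchical Follow the Perturbed Leader) employs at time $t$ the prediction of expert $i_t:=I_t^{\tilde I_t}$, where $$I_t^K:=\arg\min_{i:\lceil k^i\rceil=K}\Big\{s_{<t}^i+\frac{k^i-q^i}{\eta_t^K}\Big\}\quad\text{and}\quad \tilde I_t:=\arg\min_{K\in\mathbb N}\Big\{s_1^{I_1^K}+\dots+s_{t-1}^{I_{t-1}^K}+\frac{\frac12+2\ln K-\tilde q^K}{\tilde\eta_t}\Big\},$$ with $(q^i)_{1\le i\le n}$ and $(\tilde q^K)_{K\in\mathbb N}$ independent random variables, each exponentially distributed with rate 1. Its expected loss $\tilde\ell_{1:T}=E[s_1^{i_1}+\dots+s_T^{i_T}]$ is bounded as follows. (a) For $\eta_t^K=\sqrt{K/(2t)}$ and $\tilde\eta_t=1/\sqrt t$ we have $$\tilde\ell_{1:T}\le s_{1:T}^i+2\sqrt{2Tk^i}\cdot\Big(1+O\Big(\frac{\ln k^i}{\sqrt{k^i}}\Big)\Big)\qquad\text{for all } i.$$ (b1) For $\tilde\eta_t=1/\sqrt{2(\tilde\ell^{\,q}_{<t}+1)}$ and $\eta_t^K=\sqrt{K/(2(\ell^K_{<t}+1))}$ we have $$\tilde\ell_{1:T}\le s_{1:T}^i+2\sqrt{2s_{1:T}^ik^i}\cdot\Big(1+O\Big(\frac{\ln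 k^i}{\sqrt{k^i}}\Big)\Big)+O(k^i)\qquad\text{for all } i.$$ (b2) For $\tilde\eta_t=1\big/\min_{K\in\mathbb N}\big\{\tilde k^K+\sqrt{(\tilde k^K)^2+2\tilde s_{<t}^K+2}\big\}$ and $\eta_t^K=\sqrt{\tfrac12}\cdot\min\big\{1,\sqrt{K/\min_{i:\lceil k^i\rceil=K}s_{<t}^i}\big\}$ we have $$\tilde\ell_{1:T}\le s_{1:T}^i+2\sqrt{2s_{1:T}^ik^i}\cdot\Big(1+O\Big(\frac{\ln k^i}{\sqrt{k^i}}\Big)\Big)+O(k^i\ln s_{1:T}^i)\qquad\text{for all } i.$$
   Context: Experts are indexed by $i$ with $1\le i\le n$ (all $i\in\mathbb N$ if $n=\infty$). $s_t^i\in[0,1]$ is the loss of expert $i$ at time $t$, $s_{1:t}^i=s_1^i+\dots+s_t^i$, $s_{<t}^i=s_1^i+\dots+s_{t-1}^i$. The number $k^i$ is called the complexity of expert $i$. ''Exponentially distributed with rate 1'' means density $e^{-x}$ for $x\ge0$; the perturbations are drawn once at the beginning. For $K\in\mathbb N=\{1,2,\dots\}$, the lower-level algorithm ${\rm FPL}^K$ is Follow the Perturbed Leader over the experts with $\lceil k^i\rceil=K$, with learning rate $\eta_t^K>0$; at time $t$ it selects $I_t^K$, has loss $\tilde s_t^K=s_t^{I_t^K}$ and expected loss $\ell_t^K=E[s_t^{I_t^K}]$, with $\ell^K_{<t}=\ell_1^K+\dots+\ell_{t-1}^K$. The upper-level (meta) algorithm, with learning rate $\tilde\eta_t>0$, treats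 the ${\rm FPL}^K$ as experts with losses $\tilde s_t^K$ and complexities $\tilde k^K=\tfrac12+2\ln K$, and selects $\tilde I_t$; $\tilde s_{<t}^K=\tilde s_1^K+\dots+\tilde s_{t-1}^K$. $\tilde\ell^{\,q}_{<t}=\sum_{\tau<t}E_{\tilde q}[\tilde s_\tau^{\tilde I_\tau}]$ is the expected past loss of the meta algorithm, with expectation over $\tilde q$ only and $q$ held fixed. The expectation in $\tilde\ell_{1:T}$ is over both $q$ and $\tilde q$. When $\min_{i:\lceil k^i\rceil=K}s_{<t}^i=0$, the minimum $\min\{1,\cdot\}$ in (b2) is read as $1$. *)

(* Defs.v *)
From HB Require Import structures.
From mathcomp Require Import all_boot all_order all_algebra finmap.
From mathcomp Require Import all_classical all_reals all_analysis.

Set Implicit Arguments.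
Unset Strict Implicit.
Unset Printing Implicit Defensive.
Import Order.TTheory GRing.Theory Num.Theory.
Import numFieldNormedType.Exports.
Local Open Scope classical_set_scope.
Local Open Scope ring_scope.

(* f = O(g) uniformly on A.  It is used on regions A where g is bounded away
   from 0: ln k / sqrt k vanishes at k = 1, k at 0 and k ln s at s = 1, and the
   O-terms are only meaningful away from these points. *)
Definition bigO_on {R : realType} {U : Type} (A : set U) (f g : U -> R) : Prop :=
  exists C : R, forall x, A x -> `|f x| <= C * `|g x|.

(* Experts, classes K and times are numbered from 1; [None] stands for
   n = infinity. *)
Definition experts (n : option nat) : set nat :=
  [set i | (1 <= i)%N /\ if n is Some m then (i <= m)%N else true].

(* The smallest index minimizing F over A.  Ties (a null event for the
   perturbed scores below) are thus broken towards the smaller index.  When no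
   minimizer exists the value is 1; this happens for the scores below only on a
   null event, or when A is empty. *)
Definition argmin {R : realType} (A : set nat) (F : nat -> R) : nat :=
  xget 1%N [set i | [/\ A i, forall j, A j -> F i <= F j &
                        forall j, A j -> F j = F i -> (i <= j)%N]].

(* s_{<t}^i ; hence s_{1:T}^i is [past_loss s i T.+1].  [s t i] is the loss of
   expert i at time t. *)
Definition past_loss {R : realType} (s : nat -> nat -> R) (i t : nat) : R :=
  \sum_(1 <= tau < t) s tau i.

Section Algorithm.
Context {R : realType} (n : option nat) (k : nat -> R) (s : nat -> nat -> R).

Definition complexity_class (K : nat) : set nat :=
  [set i | experts n i /\ Num.ceil (k i) = K%:Z].

(* FPL^K only exists for nonempty classes.  If the single complexity is
   k^1 = 0 (so n = 1), no class is active and every [argmin] below returns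
   expert 1, the only possible prediction. *)
Definition active_classes : set nat :=
  [set K | (1 <= K)%N /\ complexity_class K !=set0].

(* In what follows [x] and [y] are realizations of the perturbations
   (q^i)_i and (q~^K)_K, and [eta K t] is eta_t^K.  The rates are parameters: an adaptive
   rate is specified by an equation whose right-hand side only involves rates
   at times < t, so the equations determine the rates by recursion on t. *)
Definition fpl_select (eta : nat -> nat -> R) (x : nat -> R) (K t : nat) :
    nat :=
  argmin (complexity_class K)
    (fun i => past_loss s i t + (k i - x i) / eta K t).

Definition fpl_loss (eta : nat -> nat -> R) (x : nat -> R) (K t : nat) : R :=
  s t (fpl_select eta x K t).

Definition fpl_past_loss (eta : nat -> nat -> R) (x : nat -> R) (K t : nat) :
    R :=
  \sum_(1 <= tau < t) fpl_loss eta x K tau.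

Definition meta_complexity (K : nat) : R := 1 / 2 + 2 * ln K%:R.

Definition meta_select (eta : nat -> nat -> R) (etat : nat -> R)
    (x y : nat -> R) (t : nat) : nat :=
  argmin active_classes
    (fun K => fpl_past_loss eta x K t + (meta_complexity K - y K) / etat t).

Definition hfpl_select (eta : nat -> nat -> R) (etat : nat -> R)
    (x y : nat -> R) (t : nat) : nat :=
  fpl_select eta x (meta_select eta etat x y t) t.

Context {d : measure_display} {Omega : measurableType d}
  (P : probability Omega R) (q qt : nat -> {RV P >-> R}).

(* l_{<t}^K *)
Definition fpl_past_expected_loss (eta : nat -> nat -> R) (K t : nat) : R :=
  \sum_(1 <= tau < t) fine 'E_P[fun w => fpl_loss eta (q ^~ w) K tau].

(* The upper rate may depend on q, whence [etat t w]. *)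
Definition hfpl_expected_loss (eta : nat -> nat -> R)
    (etat : nat -> Omega -> R) (T : nat) : \bar R :=
  'E_P[fun w => \sum_(1 <= t < T.+1)
         s t (hfpl_select eta (etat ^~ w) (q ^~ w) (qt ^~ w) t)].

(* l~^q_{<t} at the outcome w: the family q and the rates are frozen at w,
   while q~ is averaged over an independent outcome w'. *)
Definition meta_past_expected_loss (eta : nat -> nat -> R)
    (etat : nat -> Omega -> R) (t : nat) (w : Omega) : R :=
  \sum_(1 <= tau < t)
    fine 'E_P[fun w' =>
      s tau (hfpl_select eta (etat ^~ w) (q ^~ w) (qt ^~ w') tau)].

(* min of s_{<t}^i over a class; the class is finite because the e^{-k^i} sum
   to at most 1. *)
Definition class_min_past_loss (K t : nat) : R :=
  inf [set past_loss s i t | i in complexity_class K].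

(* min over K of k~^K + sqrt ((k~^K)^2 + 2 s~_{<t}^K + 2), attained since k~^K
   tends to infinity. *)
Definition meta_min_scale (eta : nat -> nat -> R) (x : nat -> R) (t : nat) :
    R :=
  inf [set meta_complexity K +
           Num.sqrt (meta_complexity K ^+ 2 + 2 * fpl_past_loss eta x K t + 2)
      | K in active_classes].

End Algorithm.

Section Independence.
Context {R : realType} {d : measure_display} {Omega : measurableType d}
  (P : probability Omega R).

Definition mutually_independent (I : choiceType) (D : set I)
    (X : I -> {RV P >-> R}) : Prop :=
  forall (J : {fset I}) (E : I -> set R),
    [set` J] `<=` D -> (forall j, measurable (E j)) ->
    P (\bigcap_(j in [set` J]) (X j @^-1` E j)) =
    (\prod_(j <- J) P (X j @^-1` E j))%E.

Definition exponentially_distributed (X : {RV P >-> R}) : Prop :=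
  forall A : set R, measurable A -> distribution P X A = exponential_prob 1 A.

(* All the q^i (1 <= i <= n) and q~^K (K >= 1), as one family. *)
Definition perturbation_index (n : option nat) : set (nat + nat) :=
  [set j | match j with inl i => experts n i | inr K => (1 <= K)%N end].

Definition perturbations (q qt : nat -> {RV P >-> R}) (j : nat + nat) :
    {RV P >-> R} :=
  match j with inl i => q i | inr K => qt K end.

End Independence.

(* Main.v *)
Require Import Defs.
From HB Require Import structures.
From mathcomp Require Import all_boot all_order all_algebra finmap.
From mathcomp Require Import all_classical all_reals all_analysis.
From mathcomp Require Import measurable_realfun ring lra.

(* Let J_t be the leader used at time t and J'_t the infeasible one that also
   sees the losses of time t.  Pathwise, J' loses at most the loss of any expert
   j plus (k_j + max_i (q_i - k_i)) / eta_T, and the maximum has expectation at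
   most 2 by a union bound.  Conditionally on the other perturbations, "expert
   i leads" is a threshold event for q_i, and the losses of one step move the
   threshold by at most eta_t, so P(J'_t = i) >= exp(- eta_t) P(J_t = i).  With
   l_t the expected loss at time t this gives
     sum_t (1 - eta_t) l_t <= s_{1:T}^j + (k_j + 2) / eta_T.
   Each choice of rates turns this inequality, taken at all times up to T, into
   a regret bound.  It is used within the class of expert i, and, for each fixed
   value of the lower perturbations q, for the meta algorithm; independence
   allows to average over the upper perturbations first.  The meta regret is
   only O((1 + ln K) sqrt(s)), and averaging it over q uses
   sqrt(s) <= s / (2 a) + a / 2. *)

Set Implicit Arguments.
Unset Strict Implicit.
Unset Printing Implicit Defensive.
Import Order.TTheory GRing.Theory Num.Theory.
Import numFieldNormedType.Exports.
Local Open Scope classical_set_scope.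
Local Open Scope ring_scope.

(** * Averaging independent families one after the other *)

(** [Omega] is an arbitrary probability space and the upper rates of (b1) and (b2) are random.
    Fixing [q] is therefore expressed on the diagonal of [Omega x Omega], each factor carrying the
    sigma-algebra of one family of perturbations. This demands upper rates measurable for the
    sigma-algebra of [q], although they are only given by equations. Rates may exceed 1, so
    [1 - eta t] may be negative; the factor stays inside the sum, and the sum of [eta t * l t] is
    bounded separately. It telescopes when the rate is built from [l] itself, as in (b1). In (b2)
    the rate is built from the losses of the competitors, and [l] is controlled only through the
    regret bounds at all earlier times; summation by parts transfers this control. The leading
    constant comes from a balance: for [eta t = sqrt (K / (2 t))], [K / eta T] equals
    [sqrt (2 T K)], and the sum of the rates is at most that. Replacing [K] by [k i + 1] at the end
    only affects the factor with the O-term. *)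

Section Independence.
Context {R : realType} {d : measure_display} {Omega : measurableType d}
  (P : probability Omega R) (I : choiceType).
Implicit Types (D : set I) (X : I -> {RV P >-> R}).

Definition cylinders D X : set (set Omega) :=
  [set E | exists (J : {fset I}) (B : I -> set R),
    [/\ [set` J] `<=` D, forall j, measurable (B j) &
        E = \bigcap_(j in [set` J]) (X j @^-1` B j)]].

(* [Omega] itself, equipped with the sigma-algebra generated by the [X i] with
   [i] in [D]. *)
Definition sigma_of D X : measurableType (sigma_display (cylinders D X)) :=
  g_sigma_algebraType (cylinders D X).

(** Makes the cylinders a pi-system, as the Dynkin induction of [indep_half] requires; [setT] fills
    in the indices that only one of the two cylinders constrains. *)
Lemma cylindersI D X : setI_closed (cylinders D X).
Proof.
move=> _ _ [J1 [B1 [JD1 mB1 ->]]] [J2 [B2 [JD2 mB2 ->]]].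
exists (J1 `|` J2)%fset, (fun j => (if j \in J1 then B1 j else setT) `&`
  (if j \in J2 then B2 j else setT)); split.
- by move=> j /=; rewrite inE => /orP[]; [exact: JD1|exact: JD2].
- by move=> j; apply: measurableI; case: ifP.
- apply/seteqP; split => x /=.
    move=> [h1 h2] j /= _; split; case: ifP => // jJ; [exact: h1|exact: h2].
  move=> h; split=> j /= jJ; have /= := h j; rewrite inE jJ ?orbT.
    by case=> //.
  by case=> //.
Qed.

Lemma measurable_cylinders D X E : cylinders D X E -> measurable E.
Proof.
move=> [J [B [_ mB ->]]]; apply: fin_bigcap_measurable => [|j _].
  exact: finite_fset.
by rewrite -[X in measurable X]setTI; exact: measurable_funP.
Qed.

Lemma measurable_sigma_of D X (E : set (sigma_of D X)) :
  measurable E -> measurable (E : set Omega).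
Proof.
move=> mE; apply: smallest_sub mE; first exact: sigma_algebra_measurable.
by move=> A; exact: measurable_cylinders.
Qed.

Lemma measurable_fun_sigma_of D X d' (T : measurableType d')
    (f : sigma_of D X -> T) :
  measurable_fun setT f -> measurable_fun setT (f : Omega -> T).
Proof. by move=> mf _ Y mY; apply: measurable_sigma_of; exact: mf. Qed.

(** The law of this identity map is [P] restricted to the smaller sigma-algebra; [P1] and [P2] below
    are such laws. *)
Lemma measurable_fun_to_sigma_of D X :
  measurable_fun setT (fun w : Omega => w : sigma_of D X).
Proof. by move=> _ Y mY; rewrite setTI; exact: measurable_sigma_of mY. Qed.

Lemma measurable_fun_coord D X i :
  D i -> measurable_fun setT (X i : sigma_of D X -> R).
Proof.
move=> Di _ Y mY; rewrite setTI; apply: sub_gen_smallest.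
exists [fset i]%fset, (fun=> Y); split => //.
  by move=> j /=; rewrite inE => /eqP ->.
apply/seteqP; split => x /=; first by move=> ? j /=; rewrite inE => /eqP ->.
by move=> /(_ i) /=; apply; rewrite inE.
Qed.

(** Since [D1] and [D2] are disjoint, the two cylinders glue to a single one, whose product formula
    then splits. *)
Lemma indep_cylinders D D1 D2 X (E1 E2 : set Omega) :
  mutually_independent D X -> D1 `<=` D -> D2 `<=` D ->
  D1 `&` D2 = set0 -> cylinders D1 X E1 -> cylinders D2 X E2 ->
  (P (E1 `&` E2) = P E1 * P E2)%E.
Proof.
move=> ind D1D D2D D12 [J1 [B1 [JD1 mB1 ->]]] [J2 [B2 [JD2 mB2 ->]]].
have J12 j : j \in J1 -> j \in J2 -> False.
  by move=> /JD1 h1 /JD2 h2; rewrite -[False]/(set0 j) -D12.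
rewrite (ind J1 B1 (subset_trans JD1 D1D))// (ind J2 B2 (subset_trans JD2
  D2D))//.
pose B j := if j \in J1 then B1 j else B2 j.
transitivity (P (\bigcap_(j in [set` (J1 `|` J2)%fset]) (X j @^-1` B j))).
  congr (P _); apply/seteqP; split => x /=.
    move=> [h1 h2] j /=; rewrite inE /B; case: ifP => [jJ _|_ /= jJ].
      exact: h1.
    exact: h2.
  move=> h; split => j /= jJ; have := h j; rewrite /= inE jJ ?orbT /B.
    by rewrite ?jJ; exact.
  by case: ifP => [jJ1|_]; [case: (J12 j)|exact].
rewrite ind; first last.
- by move=> j; rewrite /B; case: ifP.
- by move=> j /=; rewrite inE => /orP[/JD1/D1D|/JD2/D2D].
rewrite (perm_big (enum_fset J1 ++ enum_fset J2)); last first.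
  apply: uniq_perm; [exact: fset_uniq| |].
    rewrite cat_uniq !fset_uniq /= andbT; apply/hasPn => j jJ2.
    by apply/negP => jJ1; exact: (J12 j).
  by move=> j; rewrite mem_cat inE.
rewrite big_cat /=; congr (_ * _)%E.
  by apply: eq_big_seq => j jJ; rewrite /B jJ.
apply: eq_big_seq => j jJ; rewrite /B; case: ifP => // jJ1.
by case: (J12 j).
Qed.

(** Dynkin induction in one argument while the other event stays fixed; [indep_sigma_of] runs it
    once on each side. *)
Lemma indep_half D X (E : set Omega) (A : set (sigma_of D X)) :
  measurable E ->
  (forall C, cylinders D X C -> P (C `&` E) = P C * P E)%E ->
  measurable A -> (P (A `&` E) = P A * P E)%E.
Proof.
move=> mE CE mA; move: A mA.
apply: (@dynkin_induction _ (sigma_of D X) (cylinders D X)) => //.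
- exact: cylindersI.
- by rewrite setTI probability_setT mul1e.
- move=> S mS PS; have mS' := measurable_sigma_of mS.
  rewrite setIC -setDE measureD//; last first.
    by rewrite (le_lt_trans (probability_le1 P mE))// ltry.
  rewrite probability_setC// setIC.
  transitivity (P E - P S * P E)%E; first by congr (_ - _)%E.
  have /fineK := fin_num_measure P S mS'; have /fineK := fin_num_measure P E mE.
  move: (fine (P E)) (fine (P S)) => e p <- <-.
  by rewrite -EFinM -!EFinB -EFinM mulrBl mul1r.
- move=> F mF tF PF; rewrite setI_bigcupl.
  have -> : P (\bigcup_n (F n `&` E)) =
      (\sum_(n <oo | n \in [set: nat]) P (F n `&` E))%E.
    apply: measure_bigcup.
      by move=> n _; apply: measurableI => //;
        exact: measurable_sigma_of (mF n).
    by move=> i j _ _ [x [[Fi _] [Fj _]]]; apply: (tF i j) => //; exists x.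
  have /fineK ef := fin_num_measure P E mE.
  transitivity (\sum_(n <oo | n \in [set: nat]) ((fine (P E))%:E * P (F n)))%E.
    by apply: eq_eseriesr => n _; rewrite ef muleC; exact: PF.
  rewrite nneseriesZl// ef muleC; congr (_ * _)%E.
  rewrite -measure_bigcup// => n _; exact: measurable_sigma_of (mF n).
Qed.

Lemma indep_sigma_of D D1 D2 X (A : set (sigma_of D1 X)) (B : set (sigma_of D2
  X)) :
  mutually_independent D X -> D1 `<=` D -> D2 `<=` D -> D1 `&` D2 = set0 ->
  measurable A -> measurable B -> (P (A `&` B) = P A * P B)%E.
Proof.
move=> ind D1D D2D D12 mA mB; apply: indep_half mA => [|C CC].
  exact: measurable_sigma_of mB.
rewrite setIC muleC; apply: (@indep_half D2 X C B) mB => [|C' CC'].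
  exact: measurable_cylinders CC.
by rewrite setIC muleC; exact: (indep_cylinders ind D1D D2D).
Qed.

Section Freezing.
Variables (D D1 D2 : set I) (X : I -> {RV P >-> R}).
Variable F : sigma_of D1 X * sigma_of D2 X -> \bar R.
Hypotheses (mF : measurable_fun setT F) (F0 : forall z, (0 <= F z)%E).

Let i1 := @measurable_fun_to_sigma_of D1 X.
Let i2 := @measurable_fun_to_sigma_of D2 X.
Let P1 := distribution P (mfun_Sub (mem_set i1)).
Let P2 := distribution P (mfun_Sub (mem_set i2)).

Let inner_integral (w : Omega) :
  (\int[P]_w' F (w, w') = fubini_F P2 F w)%E.
Proof.
rewrite /fubini_F /P2 ge0_integral_distribution//.
by apply: measurableT_comp mF _; exact: measurable_fun_pair.
Qed.

Lemma measurable_inner_integral :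
  measurable_fun setT (fun w : sigma_of D1 X => \int[P]_w' F (w, w'))%E.
Proof.
rewrite (_ : (fun _ => _) = fubini_F P2 F); last exact/funext/inner_integral.
exact: measurable_fun_fubini_tonelli_F.
Qed.

(** By independence the diagonal map [w -> (w, w)] has law [P1 x P2], so an integral along the
    diagonal is a product integral and Tonelli applies. *)
Lemma freezing : mutually_independent D X -> D1 `<=` D -> D2 `<=` D ->
  D1 `&` D2 = set0 ->
  (\int[P]_w F (w, w) = \int[P]_w \int[P]_w' F (w, w'))%E.
Proof.
move=> ind D1D D2D D12.
pose diag (w : Omega) : sigma_of D1 X * sigma_of D2 X := (w, w).
have mdiag : measurable_fun setT diag by exact: measurable_fun_pair.
pose Pd := distribution P (mfun_Sub (mem_set mdiag)).
have PE S : measurable S -> (P1 \x P2)%E S = Pd S.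
  apply: (@product_measure_unique _ _ (sigma_of D1 X) (sigma_of D2 X) R P1 P2
    Pd).
  move=> A B mA mB; exact: indep_sigma_of ind D1D D2D D12 mA mB.
transitivity (\int[Pd]_z F z)%E.
  by rewrite /Pd ge0_integral_distribution.
transitivity (\int[(P1 \x P2)%E]_z F z)%E.
  by apply: eq_measure_integral => S mS _; apply/esym; exact: PE.
rewrite fubini_tonelli1// /P1 ge0_integral_distribution; last 2 first.
  exact: measurable_fun_fubini_tonelli_F.
  by move=> w; apply: integral_ge0 => w' _.
by apply: eq_integral => w _ /=; rewrite inner_integral.
Qed.

End Freezing.

Lemma measurable_section D1 D2 X (V : set (sigma_of D1 X * sigma_of D2 X)) w :
  measurable V -> measurable [set w' : Omega | V (w, w')].
Proof.
move=> mV; apply: (@measurable_sigma_of D2 X);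
  rewrite -[X in measurable X]setTI.
by apply: (@measurable_pair1 _ _ (sigma_of D1 X) (sigma_of D2 X)).
Qed.

Lemma measurable_diagonal D1 D2 X (V : set (sigma_of D1 X * sigma_of D2 X)) :
  measurable V -> measurable [set w : Omega | V (w, w)].
Proof.
move=> mV; rewrite -[X in measurable X]setTI.
have h : measurable_fun setT (fun w : Omega =>
  (w, w) : sigma_of D1 X * sigma_of D2 X).
  by apply: measurable_fun_pair; exact: measurable_fun_to_sigma_of.
exact: h.
Qed.

Section FreezingSet.
Variables (D D1 D2 : set I) (X : I -> {RV P >-> R}).
Variable V : set (sigma_of D1 X * sigma_of D2 X).
Hypothesis mV : measurable V.

Let mF : measurable_fun setT (fun z => (\1_V z)%:E : \bar R).
Proof. exact/measurable_EFinP. Qed.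

Let F0 z : (0 <= ((\1_V z)%:E : \bar R))%E. Proof. by rewrite lee_fin. Qed.

Let inner w : (\int[P]_w' (\1_V (w, w'))%:E = P [set w' | V (w, w')])%E.
Proof.
have mVw := measurable_section w mV.
rewrite -[X in P X]setIT -(@integral_indic _ _ _ P setT measurableT)//.
Qed.

Lemma measurable_probability_section :
  measurable_fun setT (fun w : Omega => P [set w' | V (w, w')]).
Proof.
rewrite (_ : (fun w => _) = (fun w => \int[P]_w' (\1_V (w, w'))%:E)%E).
  exact: measurable_fun_sigma_of (measurable_inner_integral mF F0).
by apply/funext => w; rewrite inner.
Qed.

Lemma freezing_set : mutually_independent D X -> D1 `<=` D -> D2 `<=` D ->
  D1 `&` D2 = set0 ->
  P [set w | V (w, w)] = (\int[P]_w P [set w' | V (w, w')])%E.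
Proof.
move=> ind D1D D2D D12; have := freezing mF F0 ind D1D D2D D12.
have md := measurable_diagonal mV.
under [RHS]eq_integral do rewrite inner.
by rewrite -[X in P X]setIT -(@integral_indic _ _ _ P setT measurableT).
Qed.

End FreezingSet.

End Independence.

(** * Exponential variables *)

Section Exponential.
Context {R : realType} {d : measure_display} {Omega : measurableType d}
  (P : probability Omega R) (X : {RV P >-> R}).
Hypothesis expX : exponentially_distributed X.

Lemma measurable_RV_preimage (Y : set R) :
  measurable Y -> measurable (X @^-1` Y).
Proof. by move=> mY; rewrite -[X in measurable X]setTI;
  exact: measurable_funP. Qed.

Let PU (S1 S2 : set Omega) : measurable S1 -> measurable S2 ->
  (forall w, S1 w -> S2 w -> False) -> P (S1 `|` S2) = (P S1 + P S2)%E.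
Proof.
move=> m1 m2 disj; apply: measureU => //.
by apply/seteqP; split => w //= [h1 h2]; exact: disj h2.
Qed.

Lemma exponential_lt0 : P [set w | X w < 0] = 0%E.
Proof.
have -> : [set w | X w < 0] = X @^-1` `]-oo, 0[.
  by apply/seteqP; split => w /=; rewrite in_itv.
rewrite -[LHS]/(distribution P X `]-oo, 0[) expX// /exponential_prob.
apply: integral0_eq => x /=; rewrite in_itv /= => x0.
by rewrite lt0_exponential_pdf.
Qed.

Lemma exponential_eq (m : R) : P [set w | X w = m] = 0%E.
Proof.
rewrite -[LHS]/(distribution P X [set m]) expX// /exponential_prob.
by rewrite integral_set1.
Qed.

(** The [max] covers negative thresholds, which occur for a leader far ahead of its rivals: there
    the probability is 1. *)
Lemma exponential_gt (m : R) :
  P [set w | m < X w] = (expR (- Num.max 0 m))%:E.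
Proof.
have mgt (x : R) : measurable [set w | x < X w].
  have -> : [set w | x < X w] = X @^-1` `]x, +oo[.
    by apply/seteqP; split => w /=; rewrite in_itv /= andbT.
  exact: measurable_RV_preimage.
have mle (x : R) : measurable [set w | X w < x].
  have -> : [set w | X w < x] = X @^-1` `]-oo, x[.
    by apply/seteqP; split => w /=; rewrite in_itv.
  exact: measurable_RV_preimage.
have meq (x : R) : measurable [set w | X w = x].
  exact: (measurable_RV_preimage (measurable_set1 x)).
have gt_pos (x : R) : 0 < x -> P [set w | x < X w] = (expR (- x))%:E.
  move=> x0; have -> : [set w | x < X w] =
      ~` ([set w | X w < 0] `|` X @^-1` `[0, x]).
    apply/seteqP; split => w /=.
      move=> h [h1|]; first by lra.
      by rewrite in_itv /=; lra.
    move=> h; rewrite ltNge; apply/negP => h1; apply: h.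
    by have [|h2] := ltP (X w) 0; [left|right; rewrite in_itv /= h1 h2].
  have mI : measurable (X @^-1` `[0, x]) by exact: measurable_RV_preimage.
  rewrite probability_setC; last exact: measurableU.
  rewrite PU//; last by move=> w /= h1; rewrite in_itv /=; lra.
  rewrite exponential_lt0 add0e -[P _]/(distribution P X `[0, x]) expX//.
  rewrite exponential_prob_itv0c// mulN1r.
  by rewrite -[X in (1 - (X - _))%E]/1%:E -!EFinB; congr _%:E; ring.
have [m0|m0] := ltP 0 m; first by rewrite gt_pos.
rewrite oppr0 expR0; apply/eqP; rewrite eq_le probability_le1//=.
have : P [set: Omega] = 1%E by exact: probability_setT.
have -> : [set: Omega] =
    [set w | X w < 0] `|` ([set w | X w = 0] `|` [set w | 0 < X w]).
  apply/seteqP; split => w //= _.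
  by have [?|?|->] := ltgtP (X w) 0; [left|right; right|right; left].
rewrite PU//; last 2 first.
  exact: measurableU.
  by move=> w /= h1 [h2|h2]; lra.
rewrite PU//; last by move=> w /=; lra.
rewrite exponential_eq exponential_lt0 !add0e => <-.
by apply: le_measure; rewrite ?inE// => w /=; lra.
Qed.

Lemma exponential_ge (m : R) :
  P [set w | m <= X w] = (expR (- Num.max 0 m))%:E.
Proof.
have mgt : measurable [set w | m < X w].
  have -> : [set w | m < X w] = X @^-1` `]m, +oo[.
    by apply/seteqP; split => w /=; rewrite in_itv /= andbT.
  exact: measurable_RV_preimage.
have -> : [set w | m <= X w] = [set w | X w = m] `|` [set w | m < X w].
  apply/seteqP; split => w /=; last by move=> []; lra.
  by rewrite le_eqVlt => /orP[/eqP|]; [left|right].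
rewrite PU//.
- by rewrite exponential_eq add0e exponential_gt.
- exact: (measurable_RV_preimage (measurable_set1 m)).
- by move=> w /= ->; rewrite ltxx.
Qed.

(** A leader may have infinitely many rivals, hence a set of thresholds; only [sup C] counts. An
    empty [C] gives probability 1 on both sides, an unbounded one 0 on the left. Lack of memory
    enters as [max 0 (c + h) <= max 0 c + h]. The passage from weak to strict inequalities will make
    the later leader unique. *)
Lemma exponential_shift (C : set R) (h : R) : 0 <= h ->
  measurable [set w : Omega | forall c, C c -> c + h < X w] ->
  ((expR (- h))%:E * P [set w : Omega | forall c, C c -> (c <= X w)%R] <=
   P [set w : Omega | forall c, C c -> (c + h < X w)%R])%E.
Proof.
move=> h0 mS.
have [->|/set0P C0] := eqVneq C set0.
  have setTE (Q : Omega -> R -> Prop) : [set w | forall c, set0 c ->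
    Q w c] = setT.
    by apply/seteqP; split => // w _ c [].
  rewrite (setTE (fun w c => c + h < X w)) (setTE (fun w c => c <= X w)).
  by rewrite probability_setT mule1 lee_fin -expR0 ler_expR oppr_le0.
have [ubC|nubC] := pselect (has_ubound C); last first.
  rewrite (_ : [set w | forall c, C c -> c <= X w] = set0) ?measure0 ?mule0//.
  by apply/seteqP; split => w //= hw; apply: nubC; exists (X w).
have -> : [set w | forall c, C c -> c <= X w] = [set w | sup C <= X w].
  apply/seteqP; split => w /= hw; first exact: ge_sup.
  by move=> c Cc; apply: le_trans hw; exact: ub_le_sup.
rewrite exponential_ge.
apply: (@le_trans _ _ (P [set w | sup C + h < X w])); last first.
  apply: le_measure; rewrite ?inE//.
    have -> : [set w | sup C + h < X w] = X @^-1` `]sup C + h, +oo[.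
      by apply/seteqP; split => w /=; rewrite in_itv /= andbT.
    exact: measurable_RV_preimage.
  move=> w /= hw c Cc; apply: le_lt_trans hw; rewrite lerD2r.
  exact: ub_le_sup.
rewrite exponential_gt -EFinM lee_fin -expRD ler_expR -opprD lerN2.
have M0 : 0 <= Num.max 0 (sup C) by rewrite le_max lexx.
have MC : sup C <= Num.max 0 (sup C) by rewrite le_max lexx orbT.
by rewrite ge_max; apply/andP; split; lra.
Qed.

End Exponential.

(** * Leaders and their measurability *)

Section Argmin.
Context {R : realType}.
Implicit Types (A : set nat) (F : nat -> R).

Definition has_argmin A F := exists2 i, A i & forall j, A j -> F i <= F j.

Lemma argminP A F : has_argmin A F ->
  A (argmin A F) /\ forall j, A j -> F (argmin A F) <= F j.
Proof.
move=> [i0 Ai0 mini0]; rewrite /argmin.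
have ex : exists i, `[< A i /\ forall j, A j -> F i <= F j >].
  by exists i0; apply/asboolP.
case: (ex_minnP ex) => m /asboolP[Am minm] lem.
case: xgetP => [i _ [Ai mini _]//|] /(_ m)[]; split => // j Aj Fji.
by apply: lem; apply/asboolP; split => // l Al; rewrite Fji; exact: minm.
Qed.

Lemma argmin_lt A F i : A i -> (forall j, A j -> j != i -> F i < F j) ->
  argmin A F = i.
Proof.
move=> Ai lti; rewrite /argmin; case: xgetP => [j _ [Aj minj _]|].
  have [//|ji] := eqVneq j i.
  by have := minj i Ai; rewrite leNgt lti.
move=> /(_ i)[]; split=> // j Aj.
  by have [->//|ji] := eqVneq j i; exact/ltW/lti.
by have [->//|ji Fji] := eqVneq j i; have := lti j Aj ji; rewrite Fji ltxx.
Qed.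

(** The second alternative is the default value of [argmin]; because of it the losses of index 1
    must also lie in [0,1] in [u01] below. *)
Lemma argmin_in A F : A (argmin A F) \/ argmin A F = 1%N.
Proof. by rewrite /argmin; case: xgetP => [i _ []|]; [left|right]. Qed.

Lemma argmin_set0 F : argmin set0 F = 1%N.
Proof. by rewrite /argmin; case: xgetP => [i _ []|]. Qed.

End Argmin.

Section Measurability.
Context {R : realType} {d : measure_display} {Z : measurableType d}.

Lemma measurable_forall (C : set nat) (Q : nat -> Z -> Prop) :
  (forall i, C i -> measurable [set z | Q i z]) ->
  measurable [set z | forall i, C i -> Q i z].
Proof.
move=> mQ; have -> : [set z | forall i, C i -> Q i z] =
    \bigcap_(i in setT) (if pselect (C i) then [set z | Q i z] else setT).
  apply/seteqP; split => z /= h i.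
    by move=> _; case: pselect => // Ci; exact: h.
  by move=> Ci; have := h i I; case: pselect.
apply: bigcapT_measurable => i; case: pselect => [Ci|_] /=; last by [].
exact: (mQ i Ci).
Qed.

Lemma measurable_le (f g : Z -> R) : measurable_fun setT f ->
  measurable_fun setT g -> measurable [set z | f z <= g z].
Proof.
move=> mf mg; rewrite (_ : [set z | _] =
    (fun z => g z - f z) @^-1` `[0, +oo[); last first.
  by apply/seteqP; split => z /=; rewrite in_itv /= andbT subr_ge0.
by rewrite -[X in measurable X]setTI; apply: measurable_funB.
Qed.

Lemma measurable_lt (f g : Z -> R) : measurable_fun setT f ->
  measurable_fun setT g -> measurable [set z | f z < g z].
Proof.
move=> mf mg; rewrite (_ : [set z | _] = ~` [set z | g z <= f z]).
  exact/measurableC/measurable_le.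
by apply/seteqP; split => z /=; rewrite ltNge; move/negP.
Qed.

Lemma measurable_eq (f g : Z -> R) : measurable_fun setT f ->
  measurable_fun setT g -> measurable [set z | f z = g z].
Proof.
move=> mf mg; rewrite (_ : [set z | _] =
    [set z | f z <= g z] `&` [set z | g z <= f z]).
  by apply: measurableI; exact: measurable_le.
apply/seteqP; split => z /=; first by move=> ->.
by move=> [h1 h2]; apply/eqP; rewrite eq_le h1.
Qed.

Lemma measurable_fun_nat (f : Z -> nat) :
  (forall i, measurable [set z | f z = i]) -> measurable_fun setT f.
Proof.
move=> mf _ Y _; rewrite setTI (_ : f @^-1` Y = \bigcup_(i in Y) [set z | f z =
  i]).
  exact: bigcup_measurable.
by apply/seteqP; split => z /=; [exists (f z)|case=> i Yi /= ->].
Qed.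

(** The fiber over [i] is the event [S i] that [i] is the smallest minimizer; the fiber over the
    default 1 also contains the event that no [S j] occurs. *)
Lemma measurable_argmin (A : set nat) (F : nat -> Z -> R) :
  (forall i, A i -> measurable_fun setT (F i)) ->
  measurable_fun setT (fun z => argmin A (F^~ z)).
Proof.
move=> mF.
pose S i := [set z | [/\ A i, forall j, A j -> F i z <= F j z &
  forall j, A j -> F j z = F i z -> (i <= j)%N]].
have mS i : measurable (S i).
  have [Ai|nAi] := pselect (A i); last first.
    by rewrite (_ : S i = set0)//; apply/seteqP; split => z // -[].
  rewrite (_ : S i = [set z | forall j, A j -> F i z <= F j z] `&`
      [set z | forall j, (A j /\ (j < i)%N) -> ~ (F j z = F i z)]); last first.
    apply/seteqP; split => z /=.
      move=> [_ h1 h2]; split=> // j [Aj ji] e; have := h2 j Aj e.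
      by rewrite leqNgt ji.
    move=> [h1 h2]; split=> // j Aj e; rewrite leqNgt; apply/negP => ji.
    exact: (h2 j).
  apply: measurableI; apply: measurable_forall => j.
    by move=> Aj; apply: measurable_le; exact: mF.
  by move=> [Aj _]; apply: measurableC; apply: measurable_eq; exact: mF.
apply: measurable_fun_nat => i.
have Suniq z j l : S j z -> S l z -> j = l.
  move=> [Aj h1 h2] [Al h3 h4].
  have e : F j z = F l z by apply/eqP; rewrite eq_le h1// h3.
  by apply/eqP; rewrite eqn_leq h2// h4.
have -> : [set z | argmin A (F^~ z) = i] =
    S i `|` [set z | i = 1%N /\ forall j, setT j -> ~ S j z].
  apply/seteqP; split => z /=; rewrite /argmin.
    case: xgetP => [j -> Sj <-|no <-]; first by left.
    by right; split => // j _; exact: no.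
  case: xgetP => [j _ Sj|no [/no//|[->//]]].
  by move=> [Si|[_ /(_ j I)/(_ Sj)//]]; exact: (Suniq z).
apply: measurableU => //.
have [->|i1] := eqVneq i 1%N; last first.
  rewrite (_ : [set z | _] = set0)//; apply/seteqP; split => z //= -[].
  by move/eqP; rewrite (negbTE i1).
rewrite (_ : [set z | _] = [set z | forall j, setT j -> ~ S j z]).
  by apply: measurable_forall => j _; exact: measurableC.
by apply/seteqP; split => z /=; [case|split].
Qed.

Lemma measurable_fun_select d' (Y : measurableType d') (N : Z -> nat)
    (f : nat -> Z -> Y) :
  measurable_fun setT N -> (forall i, measurable_fun setT (f i)) ->
  measurable_fun setT (fun z => f (N z) z).
Proof.
move=> mN mf _ B mB; rewrite setTI (_ : _ @^-1` B =
    \bigcup_i ([set z | N z = i] `&` f i @^-1` B)).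
  apply: bigcupT_measurable => i; apply: measurableI.
    by rewrite -[X in measurable X]setTI; exact: (mN measurableT [set i]).
  by rewrite -[X in measurable X]setTI; exact: mf.
by apply/seteqP; split => z /=; [exists (N z)|case=> i _ /= [->]].
Qed.

End Measurability.

(** * Follow the Perturbed Leader *)

Section Pathwise.
Context {R : realType}.

Lemma past_lossS (u : nat -> nat -> R) j t : (1 <= t)%N ->
  past_loss u j t.+1 = past_loss u j t + u t j.
Proof. by move=> t1; rewrite /past_loss big_nat_recr. Qed.

(* [g t] is [1 / eta t], with [g 0 = 0]. *)
Lemma be_the_leader (A : set nat) (u : nat -> nat -> R) (c g : nat -> R) (M : R)
    (J : nat -> nat) (T : nat) :
  (forall i, A i -> 0 <= c i + M) ->
  g 0%N = 0 -> (forall t, (t < T)%N -> g t <= g t.+1) ->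
  (forall t, (1 <= t <= T)%N -> A (J t) /\ forall i, A i ->
     past_loss u (J t) t.+1 + c (J t) * g t <=
       past_loss u i t.+1 + c i * g t) ->
  forall i, A i ->
  \sum_(1 <= t < T.+1) u t (J t) <= past_loss u i T.+1 + (c i + M) * g T.
Proof.
move=> cM g0; elim: T => [|T IH] gmono HJ i Ai.
  by rewrite /past_loss !big_geq// g0 mulr0 addr0.
have [AJ minJ] := HJ T.+1 (leqnn _).
(* The comparator of the first [T] steps is the leader of step [T.+1]. By [cM], replacing [g T] by
   the larger [g T.+1] only increases its bound. *)
have IHJ : \sum_(1 <= t < T.+1) u t (J t) <=
    past_loss u (J T.+1) T.+1 + (c (J T.+1) + M) * g T.
  apply: IH => // [t tT|t /andP[t1 tT]]; first by apply: gmono; exact: ltnW.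
  by apply: HJ; rewrite t1 ltnW.
rewrite big_nat_recr//=.
have := ler_wpM2l (cM _ AJ) (gmono T (ltnSn T)).
have := minJ i Ai; rewrite !(@past_lossS _ _ T.+1)//; lra.
Qed.

Lemma has_argmin_bounded (A : set nat) (F : nat -> R) (N j0 : nat) :
  A j0 -> (forall j, A j -> (N <= j)%N -> F j0 <= F j) -> has_argmin A F.
Proof.
move=> Aj0 big; have j0N : (j0 < maxn N j0.+1)%N by rewrite leq_max leqnn orbT.
have AO : `[< A (Ordinal j0N) >] by apply/asboolP.
have [i /asboolP Ai mini] :=
  @arg_minP _ _ _ (Ordinal j0N) (fun i => `[< A (val i) >]) (fun i =>
    F (val i)) AO.
exists (val i) => // j Aj; have [jN|jN] := ltnP j (maxn N j0.+1).
  by have := mini (Ordinal jN) (asboolT Aj).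
apply: le_trans (mini (Ordinal j0N) AO) _; apply: big => //.
by apply: leq_trans jN; rewrite leq_maxl.
Qed.

End Pathwise.

(** * Stability of the leader under the losses of one step *)

Section LeaderShift.
Context {R : realType} {d : measure_display} {Omega : measurableType d}
  (P : probability Omega R) (A : set nat) (X : nat -> {RV P >-> R})
  (kap : nat -> R).
Hypotheses (indX : mutually_independent A X)
  (expX : forall j, A j -> exponentially_distributed (X j))
  (kap0 : forall j, A j -> 0 <= kap j)
  (kraft : (\sum_(j <oo | j \in A) (expR (- kap j))%:E <= 2%:E)%E).

Definition score (a : nat -> R) (eta : R) (w : Omega) (j : nat) : R :=
  a j + (kap j - X j w) / eta.

Lemma measurable_score a eta j : measurable_fun setT (fun w => score a eta w j).
Proof.
apply: measurable_funD => //; apply: measurable_funM => //.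
exact: measurable_funB.
Qed.

(* For fixed perturbations of the others, [j] leads iff [X j] exceeds a threshold.
   A loss of at most 1 raises it by at most [eta], which costs a factor
   [exp (- eta)] since the exponential distribution is memoryless. *)
Lemma leader_shift (a a' : nat -> R) (eta : R) (j : nat) :
  A j -> 0 < eta -> (forall i, A i -> a i <= a' i) -> a' j <= a j + 1 ->
  ((expR (- eta))%:E *
    P [set w | forall i, A i /\ i != j ->
      (score a eta w j <= score a eta w i)%R]
   <= P [set w | forall i, A i /\ i != j ->
          (score a' eta w j < score a' eta w i)%R])%E.
Proof.
move=> Aj eta0 aa' a'j.
(* The perturbations of the rivals, indexed by [D1], get frozen; only [X j] stays random. *)
pose D1 := [set i | A i /\ i != j]; pose D2 := [set j].
have D1A : D1 `<=` A by move=> i [].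
have D2A : D2 `<=` A by move=> i ->.
have D12 : D1 `&` D2 = set0.
  by apply/seteqP; split => i //= [[_ /eqP]].
pose mixed (b : nat -> R) i (z : sigma_of D1 X * sigma_of D2 X) : R * R :=
  (b j + (kap j - X j z.2) / eta, b i + (kap i - X i z.1) / eta).
have m1 b i : measurable_fun setT (fun z => (mixed b i z).1).
  apply: measurable_funD => //; apply: measurable_funM => //.
  apply: measurable_funB => //.
  by apply: (measurableT_comp (@measurable_fun_coord _ _ _ _ _ D2 X j _)).
have m2 b i : D1 i -> measurable_fun setT (fun z => (mixed b i z).2).
  move=> D1i; apply: measurable_funD => //; apply: measurable_funM => //.
  apply: measurable_funB => //.
  by apply: (measurableT_comp (@measurable_fun_coord _ _ _ _ _ D1 X i _)).
pose S := [set z | forall i, D1 i -> (mixed a i z).1 <= (mixed a i z).2].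
pose S' := [set z | forall i, D1 i -> (mixed a' i z).1 < (mixed a' i z).2].
have mS : measurable S.
  by apply: measurable_forall => i D1i; apply: measurable_le => //; exact: m2.
have mS' : measurable S'.
  by apply: measurable_forall => i D1i; apply: measurable_lt => //; exact: m2.
rewrite [X in (_ * P X <= _)%E](_ : _ = [set w | S (w, w)])//.
rewrite [X in (_ <= P X)%E](_ : _ = [set w | S' (w, w)])//.
rewrite (freezing_set mS indX D1A D2A D12) (freezing_set mS' indX D1A D2A D12).
rewrite -ge0_integralZl_EFin ?expR_ge0//;
  last exact: measurable_probability_section.
have mS2 := measurable_probability_section mS.
have mS2' := measurable_probability_section mS'.
apply: ge0_le_integral => //.
- by move=> w _; rewrite mule_ge0// lee_fin expR_ge0.
- exact: measurable_funeM.
move=> w _.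
(* The thresholds set by the rivals under the losses [a]: by [key], [eta] times a difference of
   scores is a threshold minus [X j]. *)
pose C := [set c | exists2 i,
  D1 i & c = eta * (a j - a i) + kap j - kap i + X i w].
have key b i w' : eta * ((b j + (kap j - X j w') / eta) -
    (b i + (kap i - X i w) / eta)) =
    eta * (b j - b i) + kap j - kap i + X i w - X j w'.
  by field; rewrite gt_eqF.
have SE : [set w' | S (w, w')] = [set w' | forall c, C c -> c <= X j w'].
  apply/seteqP; split => w' /= Sw.
    move=> c [i D1i ->]; have := Sw i D1i; rewrite /mixed /=.
    by rewrite -subr_le0 -(pmulr_rle0 _ eta0) key subr_le0.
  move=> i D1i; rewrite /mixed /= -subr_le0 -(pmulr_rle0 _ eta0) key subr_le0.
  by apply: Sw; exists i.
have mC : measurable [set w' : Omega | forall c, C c -> c + eta < X j w'].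
  rewrite (_ : [set w' | _] = [set w' : Omega | forall i, D1 i ->
      eta * (a j - a i) + kap j - kap i + X i w + eta < X j w']); last first.
    apply/seteqP; split => w' /= h; first by move=> i D1i; apply: h; exists i.
    by move=> c [i D1i ->]; exact: h.
  by apply: measurable_forall => i D1i; exact: measurable_lt.
rewrite SE; apply: (le_trans (exponential_shift (expX Aj) (ltW eta0) mC)).
apply: le_measure; rewrite ?inE//; first exact: measurable_section mS'.
move=> w' /= h i D1i; rewrite /mixed /= -subr_lt0 -(pmulr_rlt0 _ eta0) key.
have : eta * (a j - a i) + kap j - kap i + X i w + eta < X j w'.
  by apply: h; exists i.
(* The loss of [j] grows by at most 1 and that of a rival does not decrease, so each threshold rises
   by at most [eta]. *)
have : eta * (a' j - a' i) <= eta * (a j + 1 - a i).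
  by rewrite ler_pM2l// lerB// aa'//; case: D1i.
lra.
Qed.

End LeaderShift.

(** * Existence of leaders and size of the largest perturbation *)

Section Excess.
Context {R : realType} {d : measure_display} {Omega : measurableType d}
  (P : probability Omega R) (A : set nat) (X : nat -> {RV P >-> R})
  (kap : nat -> R).
Hypotheses (expX : forall j, A j -> exponentially_distributed (X j))
  (kap0 : forall j, A j -> 0 <= kap j)
  (kraft : (\sum_(j <oo | j \in A) (expR (- kap j))%:E <= 2%:E)%E).

(** Borel-Cantelli: [kap j - X j <= c] has probability at most [exp (c - kap j)], which is summable
    in [j]. Almost surely, for every integer [c], this happens for finitely many [j] only, so the
    scores tend to infinity. One null set serves all [F], [eta] and [j0]. *)
Lemma as_has_argmin : {ae P, forall w, forall (F : nat -> R) eta j0,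
  A j0 -> 0 < eta -> (forall j, A j -> (kap j - X j w) / eta <= F j) ->
  has_argmin A F}.
Proof.
pose E (c j : nat) : set Omega :=
  if j \in A then [set w | kap j - c%:R <= X j w] else set0.
have mE c j : measurable (E c j).
  rewrite /E; case: ifP => // _; apply: measurable_le => //.
have PE c j : (P (E c j) <=
    if j \in A then (expR c%:R)%:E * (expR (- kap j))%:E else 0)%E.
  rewrite /E; case: ifPn => [/set_mem Aj|]; last by rewrite measure0.
  rewrite (exponential_ge (expX Aj)) -EFinM lee_fin -expRD ler_expR.
  have := @le_max _ _ (kap j - c%:R) 0 (kap j - c%:R).
  by rewrite lexx orbT; lra.
have null c : P (lim_sup_set (E c)) = 0%E.
  apply: lim_sup_set_cvg0 => //.
  apply: (@le_lt_trans _ _ ((expR c%:R)%:E * 2%:E)%E);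
    last by rewrite -EFinM ltry.
  apply: (@le_trans _ _ (\sum_(j <oo | j \in A)
      ((expR c%:R)%:E * (expR (- kap j))%:E))%E).
    rewrite [leRHS]eseries_mkcond; apply: lee_nneseries => // j _.
    exact: PE.
  rewrite nneseriesZl; last by move=> j _; rewrite lee_fin expR_ge0.
  by rewrite lee_pmul2l// lte_fin expR_gt0.
have ae_notin c : {ae P, forall w, ~ lim_sup_set (E c) w}.
  exists (lim_sup_set (E c)); split => //.
    apply: bigcap_measurable => [|n _]; first by exists 0%N.
    by apply: bigcup_measurable => j _.
  by move=> w /= /contrapT.
have := @ae_foralln _ _ _ P _ ae_notin.
apply: filterS => w hw F eta j0 Aj0 eta0 lbF.
(* If [kap j - X j w > c], then [F j] exceeds [F j0]; this holds for all large [j] in [A]. *)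
pose c := (Num.truncn `|eta * F j0|).+1.
have Fc : eta * F j0 < c%:R.
  by rewrite (le_lt_trans (ler_norm _))// truncnS_gt.
have /existsNP[N /not_implyP[_ hN]] := hw c.
have AN j : A j -> (N <= j)%N -> F j0 <= F j.
  move=> Aj Nj; apply: le_trans (lbF j Aj); rewrite ler_pdivlMr// mulrC.
  rewrite leNgt; apply/negP => h; apply: hN; exists j => //=.
  by rewrite /E mem_set//=; lra.
exact: has_argmin_bounded Aj0 AN.
Qed.

(** The expectation is the integral of the tail: as [kap j >= 0], [X j] exceeds [kap j + r] with
    probability [exp (- kap j)] times the exponential density at [r], and that density has integral
    1. *)
Lemma expectation_excess j : A j ->
  ('E_P[fun w => (Num.max 0 (X j w - kap j))%R] = (expR (- kap j))%:E)%E.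
Proof.
move=> Aj.
have mY : measurable_fun setT (fun w => Num.max 0 (X j w - kap j)).
  by apply: measurable_maxr => //; exact: measurable_funB.
pose Y : {RV P >-> R} := mfun_Sub (mem_set mY).
have Y0 w : 0 <= Y w by rewrite /Y /= le_max lexx.
rewrite -[LHS]/('E_P[Y])%E ge0_expectation_ccdf//.
transitivity (\int[lebesgue_measure]_(r in `[0%R, +oo[)
   ((expR (- kap j))%:E * (exponential_pdf 1 r)%:E))%E.
  apply: eq_integral => r; rewrite inE /= in_itv /= andbT => r0.
  rewrite /ccdf exponential_pdfE// mul1r mulN1r.
  transitivity (P [set w | kap j + r < X j w]).
    congr (P _); apply/seteqP; split => w /=; rewrite in_itv /= andbT lt_max.
      by move=> /orP[|]; lra.
    by move=> h; apply/orP; right; lra.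
  rewrite (exponential_gt (expX Aj)) -EFinM -expRD; congr (expR _)%:E.
  by rewrite max_r; [ring|rewrite addr_ge0// kap0].
rewrite ge0_integralZl_EFin ?expR_ge0//=; last 2 first.
  by move=> r _; rewrite lee_fin exponential_pdf_ge0.
  apply/measurable_EFinP; apply: measurable_funTS.
  exact: measurable_exponential_pdf.
rewrite [X in (_ * X)%E](_ : _ = 1%E) ?mule1//.
rewrite -(@integral_exponential_pdf R 1)// integral_mkcond.
apply: eq_integral => r _; rewrite patchE; case: ifPn => //.
rewrite notin_setE /= in_itv /= andbT => /negP; rewrite -ltNge => r0.
by rewrite lt0_exponential_pdf.
Qed.

(* An upper bound of [max_j (X j - kap j)], with an easy expectation. *)
Definition excess (w : Omega) : \bar R :=
  (\sum_(j <oo | j \in A) (Num.max 0 (X j w - kap j))%:E)%E.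

Lemma excess_ge0 w : (0 <= excess w)%E.
Proof. by apply: nneseries_ge0 => j _ _; rewrite lee_fin le_max lexx. Qed.

Let mterm j : measurable_fun setT (fun w : Omega =>
  (if j \in A then (Num.max 0 (X j w - kap j))%:E else 0 : \bar R)%E).
Proof.
case: (j \in A) => //; apply/measurable_EFinP.
by apply: measurable_maxr => //; exact: measurable_funB.
Qed.

Let term0 j w : (0 <= if j \in A then (Num.max 0 (X j w - kap j))%:E else 0)%E.
Proof. by case: ifP => // _; rewrite lee_fin le_max lexx. Qed.

Lemma measurable_excess : measurable_fun setT excess.
Proof.
rewrite (_ : excess = fun w => (\sum_(j <oo)
    (if j \in A then (Num.max 0 (X j w - kap j))%:E else 0))%E); last first.
  by apply/funext => w; rewrite /excess eseries_mkcond.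
exact: ge0_emeasurable_sum.
Qed.

Lemma integral_excess : (\int[P]_w excess w <= 2%:E)%E.
Proof.
apply: le_trans kraft; under eq_integral do rewrite /excess eseries_mkcond.
rewrite integral_nneseries// [leRHS]eseries_mkcond.
apply: lee_nneseries => j _; first by move=> _; exact: integral_ge0.
case: ifPn => [/set_mem Aj|_]; last by rewrite integral0.
by rewrite -(expectation_excess Aj) unlock.
Qed.

Lemma excessP w j : A j -> ((X j w - kap j)%:E <= excess w)%E.
Proof.
move=> Aj; apply: (@le_trans _ _ (Num.max 0 (X j w - kap j))%:E).
  by rewrite lee_fin le_max lexx orbT.
apply: le_trans (nneseries_lim_ge j.+1 _); last first.
  by move=> i _ _; rewrite lee_fin le_max lexx.
rewrite big_mkord (bigD1 ord_max) /=; last exact: mem_set.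
by rewrite leeDl// sume_ge0// => i _; rewrite lee_fin le_max lexx.
Qed.

End Excess.

Section Expectation.
Context {R : realType} {d : measure_display} {Omega : measurableType d}
  (P : probability Omega R).

Lemma expectationE (f : Omega -> R) : ('E_P[f] = \int[P]_w (f w)%:E)%E.
Proof. by rewrite unlock. Qed.

Lemma fine_expectation (f : Omega -> R) : measurable_fun setT f ->
  (forall w, 0 <= f w <= 1) ->
  (fine 'E_P[f])%:E = ('E_P[f])%E /\ 0 <= fine 'E_P[f] <= 1.
Proof.
move=> mf f01; have ge0 : (0 <= 'E_P[f])%E.
  by apply: expectation_ge0 => w; case/andP: (f01 w).
have le1 : ('E_P[f] <= 1)%E.
  rewrite -(@probability_setT _ _ _ P) -[X in P X]setIT -(integral_indic P
    measurableT)//.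
  rewrite expectationE; apply: ge0_le_integral => //.
  - by move=> w _; rewrite lee_fin; case/andP: (f01 w).
  - by apply/measurable_EFinP.
  - by apply/measurable_EFinP.
  - by move=> w _; rewrite lee_fin indicT; case/andP: (f01 w).
have fin : 'E_P[f]%E \is a fin_num.
  by rewrite ge0_fin_numE// (le_lt_trans le1)// ltry.
split; first by rewrite fineK.
by rewrite -!lee_fin fineK// ge0 le1.
Qed.

Lemma measurable_fiber (N : Omega -> nat) (n : nat) :
  measurable_fun setT N -> measurable [set w | N w = n].
Proof.
move=> mN; rewrite -[X in measurable X]setTI; exact: (mN measurableT [set n]).
Qed.

(** Splits an expected loss according to who leads, so that [leader_le] reduces to one expert at a
    time. *)
Lemma expectation_discrete (N : Omega -> nat) (v : nat -> R) :
  measurable_fun setT N -> (forall n, 0 <= v n) ->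
  ('E_P[fun w => v (N w)] = \sum_(n <oo) (v n)%:E * P [set w | N w = n])%E.
Proof.
move=> mN v0; rewrite expectationE.
have mNn n := measurable_fiber n mN.
have -> : (fun w => (v (N w))%:E) =
    (fun w => \sum_(n <oo) ((v n)%:E * (\1_[set w | N w = n] w)%:E)%E)%E.
  apply/funext => w; rewrite (@nneseriesD1 _ _ (N w))//=; last first.
    by move=> n _; rewrite mule_ge0// lee_fin.
  rewrite indicE mem_set//= mule1 eseries0 ?adde0// => n _ /= nN.
  by rewrite indicE memNset ?mule0//= => /esym/eqP; rewrite (negbTE nN).
rewrite integral_nneseries//; last 2 first.
  by move=> n; apply: measurable_funeM; apply/measurable_EFinP.
  by move=> n w _; rewrite mule_ge0// lee_fin.
apply: eq_eseriesr => n _; rewrite ge0_integralZl_EFin//.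
- by rewrite integral_indic ?setIT.
- by apply/measurable_EFinP.
Qed.

Lemma ae_le_measure (E F : set Omega) : measurable E -> measurable F ->
  {ae P, forall w, E w -> F w} -> (P E <= P F)%E.
Proof.
move=> mE mF [N [mN N0 EFN]].
apply: (@le_trans _ _ (P (F `|` N))).
  apply: le_measure; rewrite ?inE//; first exact: measurableU.
  move=> w Ew; have [Nw|nNw] := pselect (N w); [by right|left].
  by apply: contrapT => nFw; apply: nNw; apply: EFN => /(_ Ew).
by apply: le_trans (measureU2 _ _ _) _ => //; rewrite [X in (_ + X)%E]N0 adde0.
Qed.

End Expectation.

(** * Regret of a single Follow the Perturbed Leader *)

Section Regret.
Context {R : realType} {d : measure_display} {Omega : measurableType d}
  (P : probability Omega R) (A : set nat) (X : nat -> {RV P >-> R})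
  (kap : nat -> R).
Hypotheses (indX : mutually_independent A X)
  (expX : forall j, A j -> exponentially_distributed (X j))
  (kap0 : forall j, A j -> 0 <= kap j)
  (kraft : (\sum_(j <oo | j \in A) (expR (- kap j))%:E <= 2%:E)%E).

Local Notation leader a eta := (fun w => argmin A (score X kap a eta w)).

Lemma measurable_leader a eta : measurable_fun setT (leader a eta).
Proof. by apply: measurable_argmin => j _; exact: measurable_score. Qed.

Lemma ae_leader a eta j0 : A j0 -> 0 < eta -> (forall j, A j -> 0 <= a j) ->
  {ae P, forall w, A (leader a eta w) /\ forall j, A j ->
     score X kap a eta w (leader a eta w) <= score X kap a eta w j}.
Proof.
move=> Aj0 eta0 a0; have := as_has_argmin expX kraft; apply: filterS => w.
move=> /(_ (score X kap a eta w) eta j0 Aj0 eta0) h; apply: argminP; apply: h.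
by move=> j Aj; rewrite /score lerDr a0.
Qed.

(** For each [n] in [A], leading under [a] implies almost surely a weak lead, [leader_shift] turns
    it into a strict lead under [a'], and a strict lead determines [argmin]; ties need no
    discussion. For [n] outside [A] the event is null. *)
Lemma leader_le (v a a' : nat -> R) (eta : R) j0 : A j0 -> 0 < eta ->
  (forall j, 0 <= v j) -> (forall j, A j -> 0 <= a j) ->
  (forall j, A j -> a j <= a' j <= a j + 1) ->
  ((expR (- eta))%:E * 'E_P[fun w => v (leader a eta w)] <=
     'E_P[fun w => v (leader a' eta w)])%E.
Proof.
move=> Aj0 eta0 v0 a0 aa'.
rewrite !expectation_discrete//; try exact: measurable_leader.
rewrite -nneseriesZl; last by move=> n _; rewrite mule_ge0// lee_fin.
have mln b n := measurable_fiber n (measurable_leader b eta).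
apply: lee_nneseries => [n _ _|n _].
  by rewrite !mule_ge0// lee_fin// expR_ge0.
rewrite muleCA lee_wpmul2l ?lee_fin//.
have aeA := ae_leader Aj0 eta0 a0.
have [An|nAn] := pselect (A n); last first.
  rewrite [X in (_ * X)%E](_ : _ = 0%E) ?mule0//; apply/eqP.
  rewrite eq_le measure_ge0 andbT -(@measure0 _ _ _ P);
    apply: ae_le_measure => //.
  by apply: filterS aeA => w [+ _] e; rewrite e.
have a'1 : a' n <= a n + 1 by case/andP: (aa' _ An).
have aa'1 i : A i -> a i <= a' i by move=> /aa' /andP[].
have ms b i : measurable_fun setT (fun w => score X kap b eta w i).
  exact: measurable_score.
apply: le_trans (le_trans _ (leader_shift kap indX expX An eta0 aa'1 a'1)) _.
  rewrite lee_wpmul2l ?lee_fin ?expR_ge0//; apply: ae_le_measure => //.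
    by apply: measurable_forall => i _; exact: measurable_le.
  by apply: filterS aeA => w [_ h] e i [Ai _]; rewrite -{1}e; exact: h.
apply: le_measure; rewrite ?inE//.
  by apply: measurable_forall => i _; exact: measurable_lt.
by move=> w /= h; apply: argmin_lt => // j Aj jn; exact: h.
Qed.

Section Game.
Variables (u : nat -> nat -> R) (eta : nat -> R) (T j0 : nat).
Hypotheses (T1 : (1 <= T)%N) (Aj0 : A j0)
  (u01 : forall t j, (1 <= t <= T)%N -> A j \/ j = 1%N -> 0 <= u t j <= 1)
  (eta0 : forall t, (1 <= t <= T)%N -> 0 < eta t)
  (etaS : forall t, (1 <= t < T)%N -> eta t.+1 <= eta t).

Let J t w := argmin A (score X kap (past_loss u ^~ t) (eta t) w).
Let J' t w := argmin A (score X kap (past_loss u ^~ t.+1) (eta t) w).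

(** [u] cut off to 0 where nothing is known about it, so that integration lemmas quantifying over
    all [t] and [j] apply; by [vE] the cut-off does not affect the losses of leaders. *)
Let v t j := if `[< (1 <= t <= T)%N /\ (A j \/ j = 1%N) >] then u t j else 0.

Let v01 t j : 0 <= v t j <= 1.
Proof.
by rewrite /v; case: asboolP => [[tT Aj]|nAj]; [exact: u01|rewrite lexx ler01].
Qed.

Let vE t (F : nat -> R) : (1 <= t <= T)%N ->
  v t (argmin A F) = u t (argmin A F).
Proof.
by move=> tT; rewrite /v; case: asboolP => // -[]; split=> //; exact: argmin_in.
Qed.

Let past_loss_ge0 j t : A j -> (t <= T.+1)%N -> 0 <= past_loss u j t.
Proof.
move=> Aj tT; rewrite /past_loss big_nat_cond sumr_ge0// =>
  i /andP[/andP[i1 it] _].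
have /andP[//] : 0 <= u i j <= 1.
by apply: u01; [rewrite i1 -ltnS (leq_trans it tT)|left].
Qed.

Let mu t a e : measurable_fun setT (fun w =>
  u t (argmin A (score X kap a e w))).
Proof.
exact: (measurable_fun_select (f := fun n _ => u t n) (measurable_leader a e)).
Qed.

Let uJ01 t (F : nat -> R) : (1 <= t <= T)%N -> 0 <= u t (argmin A F) <= 1.
Proof. by move=> tT; rewrite -vE. Qed.

(** [leader_le] gives the factor [exp (- eta t)], which is at least [1 - eta t] for every real rate,
    also for those above 1. *)
Let one_step t : (1 <= t <= T)%N ->
  (1 - eta t) * fine 'E_P[fun w => u t (J t w)] <=
  fine 'E_P[fun w => u t (J' t w)].
Proof.
move=> /[dup] tT /andP[t1 tT'].
have [e l01] := @fine_expectation _ _ _ P _ (mu t (past_loss u ^~ t) (eta t))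
  (fun w => uJ01 _ tT).
have [e' l01'] := @fine_expectation _ _ _ P _ (mu t (past_loss u ^~ t.+1) (eta
  t)) (fun w => uJ01 _ tT).
apply: (@le_trans _ _ (expR (- eta t) * fine 'E_P[fun w => u t (J t w)])).
  rewrite ler_wpM2r//; first by case/andP: l01.
  exact: expR_ge1Dx.
rewrite -lee_fin EFinM e e'.
have -> a : (fun w => u t (argmin A (score X kap a (eta t) w))) =
    (fun w => v t (argmin A (score X kap a (eta t) w))).
  by apply/funext => w; rewrite vE.
rewrite (_ : (fun w => u t (J' t w)) = (fun w => v t (J' t w))); last first.
  by apply/funext => w; rewrite /J' vE.
apply: (leader_le Aj0) => //; first exact: eta0.
- by move=> j; case/andP: (v01 t j).
- by move=> j Aj; rewrite past_loss_ge0// leqW.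
- move=> j Aj; rewrite past_lossS//; have := u01 tT (or_introl Aj); lra.
Qed.

(** [be_the_leader] with [kap j - X j w] as regularizer; the contribution [- X j0 w / eta T] of the
    comparator has the right sign and is dropped. *)
Let path_regret w (M : R) : (forall t, (1 <= t <= T)%N ->
  A (J' t w) /\ forall j, A j ->
     score X kap (past_loss u ^~ t.+1) (eta t) w (J' t w) <=
     score X kap (past_loss u ^~ t.+1) (eta t) w j) ->
  (forall j, A j -> X j w - kap j <= M) -> 0 <= X j0 w ->
  \sum_(1 <= t < T.+1) u t (J' t w) <=
    past_loss u j0 T.+1 + kap j0 / eta T + (eta T)^-1 * M.
Proof.
move=> HJ HM X0; pose g t := if t is 0%N then 0 else (eta t)^-1.
have gT : g T = (eta T)^-1 by rewrite /g; case: T T1.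
have etaT : 0 < (eta T)^-1 by rewrite invr_gt0 eta0// T1 leqnn.
apply: (@le_trans _ _ (past_loss u j0 T.+1 + (kap j0 - X j0 w + M) * g T)).
  apply: (be_the_leader (A := A) (c := fun j =>
    kap j - X j w) (J := J'^~ w)) => //.
  - by move=> i Ai; have := HM i Ai; lra.
  - move=> [|t] tT /=; first by rewrite ltW// invr_gt0 eta0.
    by rewrite lef_pV2 ?posrE ?eta0 ?etaS//= ltnW.
  - move=> t /[dup] tT /HJ[AJ minJ]; split=> // i Ai.
    have -> : g t = (eta t)^-1 by rewrite /g; case: t tT {AJ minJ}.
    exact: minJ.
rewrite gT; have : 0 <= X j0 w * (eta T)^-1 by rewrite mulr_ge0// ltW.
lra.
Qed.

Let ae_regret : {ae P, forall w, setT w ->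
  (\sum_(1 <= t < T.+1) (v t (J' t w))%:E <=
   (past_loss u j0 T.+1 + kap j0 / eta T)%:E + (eta T)^-1%:E * excess A X kap
     w)%E}.
Proof.
have etaT : 0 < (eta T)^-1 by rewrite invr_gt0 eta0// T1 leqnn.
have lead : {ae P, forall w t, (1 <= t <= T)%N -> A (J' t w) /\ forall j, A j ->
     score X kap (past_loss u ^~ t.+1) (eta t) w (J' t w) <=
     score X kap (past_loss u ^~ t.+1) (eta t) w j}.
  apply: ae_foralln => t; have [tT|tT] := boolP (1 <= t <= T)%N; last first.
    by apply: aeW => w.
  have et := eta0 tT; have :=
    @ae_leader (past_loss u ^~ t.+1) (eta t) j0 Aj0 et.
  case/andP: tT => t1 tT h; apply: filterS (h _) => [//|j Aj].
  exact: past_loss_ge0.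
have pos : {ae P, forall w, 0 <= X j0 w}.
  exists [set w | X j0 w < 0]; split.
  - exact: measurable_lt.
  - exact: exponential_lt0 (expX Aj0).
  - by move=> w /= /negP; rewrite -ltNge.
apply: filterS2 lead pos => w HJ X0 _.
(* An infinite excess makes the bound trivial, so its almost sure finiteness does not have to be
   proved first. *)
have [excy|excfin] := eqVneq (excess A X kap w) +oo%E.
  by rewrite excy gt0_muley ?lte_fin// addey// leey.
have fin : excess A X kap w \is a fin_num.
  by rewrite ge0_fin_numE ?excess_ge0// ltey.
rewrite -(fineK fin) -EFinM -EFinD sumEFin lee_fin.
rewrite (eq_big_nat _ _ (F2 := fun t => u t (J' t w))); last first.
  by move=> t tT; rewrite /J' vE.
apply: path_regret => // j Aj; rewrite -lee_fin fineK//.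
exact: excessP.
Qed.

(** [u] is arbitrary so that it can also stand for the losses of the [FPL^K] at a frozen [q], which
    form a deterministic sequence. *)
Theorem fpl_regret :
  \sum_(1 <= t < T.+1) (1 - eta t) *
    fine 'E_P[fun w => u t (argmin A (fun i =>
      past_loss u i t + (kap i - X i w) / eta t))]
  <= past_loss u j0 T.+1 + (kap j0 + 2) / eta T.
Proof.
have etaT : 0 < eta T by apply: eta0; rewrite T1 leqnn.
apply: (@le_trans _ _ (\sum_(1 <= t < T.+1) fine 'E_P[fun w => u t (J' t w)])).
  rewrite big_nat_cond [leRHS]big_nat_cond; apply: ler_sum => t /andP[tT _].
  exact: one_step.
have mvR t : measurable_fun setT (fun w => v t (J' t w)).
  exact: (measurable_fun_select (f := fun n _ =>
    v t n) (measurable_leader _ _)).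
have mv t : measurable_fun setT (fun w => (v t (J' t w))%:E).
  by apply/measurable_EFinP.
have v0 t w : (0 <= (v t (J' t w))%:E)%E by rewrite lee_fin;
  case/andP: (v01 t (J' t w)).
have -> : \sum_(1 <= t < T.+1) fine 'E_P[fun w => u t (J' t w)] =
    \sum_(1 <= t < T.+1) fine (\int[P]_w (v t (J' t w))%:E).
  apply: eq_big_nat => t tT; rewrite expectationE; congr fine.
  by apply: eq_integral => w _; rewrite /J' vE.
rewrite -lee_fin -sumEFin.
rewrite (eq_big_nat _ _ (F2 := fun t => \int[P]_w (v t (J' t w))%:E)%E);
  last first.
  move=> t tT; rewrite -expectationE.
  by have [] := @fine_expectation _ _ _ P (fun w => v t (J' t w)) (mvR t)
    (fun w => v01 _ _).
rewrite -ge0_integral_sum//.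
apply: le_trans (ae_ge0_le_integral _ _ _ _ _ ae_regret) _ => //.
- by move=> w _; apply: sume_ge0 => t _.
- exact: emeasurable_sum.
- move=> w _; rewrite adde_ge0//.
    rewrite lee_fin addr_ge0 ?past_loss_ge0// mulr_ge0 ?kap0// invr_ge0 ltW//.
  by rewrite mule_ge0 ?excess_ge0// lee_fin invr_ge0 ltW.
- apply: emeasurable_funD => //; apply: measurable_funeM.
  exact: measurable_excess.
rewrite ge0_integralD//; last 3 first.
- by move=> w _; rewrite lee_fin addr_ge0 ?past_loss_ge0// mulr_ge0 ?kap0//
  invr_ge0 ltW.
- by move=> w _; rewrite mule_ge0 ?excess_ge0// lee_fin invr_ge0 ltW.
- apply: measurable_funeM; exact: measurable_excess.
rewrite integral_cst// [X in (_ * X + _)%E]probability_setT mule1.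
rewrite ge0_integralZl_EFin//; last 3 first.
- by move=> w _; exact: excess_ge0.
- exact: measurable_excess.
- by rewrite invr_ge0 ltW.
have -> : past_loss u j0 T.+1 + (kap j0 + 2) / eta T =
  (past_loss u j0 T.+1 + kap j0 / eta T) + (eta T)^-1 * 2 by ring.
rewrite [leRHS]EFinD [X in (_ <= _ + X)%E]EFinM leeD2l// lee_wpmul2l//.
  by rewrite lee_fin invr_ge0 ltW.
exact: integral_excess.
Qed.

End Game.

End Regret.

(** * Learning rates *)

Section RateLemmas.
Context {R : realType}.
Implicit Types (a b x y : R) (T : nat).

Lemma ln_le_subr1 x : 0 < x -> ln x <= x - 1.
Proof. by move=> x0; have := expR_ge1Dx (ln x); rewrite lnK ?posrE//; lra. Qed.

Lemma ln_step a b : 0 < a -> 0 < b -> 1 - a / b <= ln b - ln a.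
Proof.
move=> a0 b0; have := ln_le_subr1 (divr_gt0 a0 b0).
by rewrite ln_div ?posrE//; lra.
Qed.

(** [b - a] is the difference of the roots times their sum, and the sum is at most [2 * c]. It makes
    increments divided by a current root telescope. *)
Lemma sqrt_step a b c : 0 <= a <= b -> Num.sqrt b <= c -> 0 < c ->
  (b - a) / c <= 2 * (Num.sqrt b - Num.sqrt a).
Proof.
move=> /andP[a0 ab] bc c0; rewrite ler_pdivrMr//.
have b0 := le_trans a0 ab;
  have sab : Num.sqrt a <= Num.sqrt b by exact: ler_wsqrtr.
rewrite -{1}(sqr_sqrtr a0) -{1}(sqr_sqrtr b0).
have := sqrtr_ge0 a; nra.
Qed.

Lemma sum_inv_sqrt T : \sum_(1 <= t < T.+1) (Num.sqrt t%:R)^-1 <=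
  2 * Num.sqrt T%:R :> R.
Proof.
elim: T => [|T IH]; first by rewrite big_geq// mulr_ge0 ?sqrtr_ge0.
rewrite big_nat_recr//=.
have := @sqrt_step T%:R T.+1%:R (Num.sqrt T.+1%:R).
rewrite ler0n ler_nat leqnSn lexx sqrtr_gt0 ltr0n -natrB// subSnn mul1r =>
  /(_ isT isT isT).
lra.
Qed.

(** Write [x] and [z] for the roots of [y + 1] and [s0]. If [x > z + B + 1], then [x * (x - B)]
    exceeds [(z + 1)^2 >= s0 + 1], while the hypothesis bounds it by [s0 + 1]. *)
Lemma quadratic_regret s0 B y : 0 <= s0 -> 0 <= B -> 0 <= y ->
  y <= s0 + B * Num.sqrt (y + 1) -> y <= s0 + B * Num.sqrt s0 + B ^+ 2 + B.
Proof.
move=> s00 B0 y0 h.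
suff : Num.sqrt (y + 1) <= Num.sqrt s0 + B + 1 by nra.
have := sqr_sqrtr s00; have : 0 <= y + 1 by lra.
move/sqr_sqrtr; have := sqrtr_ge0 s0; have := sqrtr_ge0 (y + 1).
rewrite leNgt => x0 z0 ex ez; apply/negP => lt.
move: (Num.sqrt (y + 1)) (Num.sqrt s0) ex ez h lt x0 z0 => x z; nra.
Qed.

Lemma sum_nat1_ge0 (l : nat -> R) t T : (t <= T)%N ->
  (forall i, (1 <= i <= T)%N -> 0 <= l i) -> 0 <= \sum_(1 <= i < t.+1) l i.
Proof.
move=> tT l0; rewrite big_nat_cond sumr_ge0// => i /andP[/andP[i1 it] _].
by rewrite l0// i1 -ltnS (leq_trans it).
Qed.

(** The rate does not see the current loss; as this is at most 1, the [+ 1] in the rate makes up for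
    it and [sqrt_step] telescopes. *)
Lemma adaptive_rate_sum (l : nat -> R) c T :
  (forall t, (1 <= t <= T)%N -> 0 <= l t <= 1) -> 0 < c ->
  \sum_(1 <= t < T.+1) Num.sqrt (c / (\sum_(1 <= tau < t) l tau + 1)) * l t <=
  2 * Num.sqrt c * Num.sqrt (\sum_(1 <= t < T.+1) l t).
Proof.
move=> l01 c0; elim: T l01 => [|T IH] l01.
  by rewrite !big_geq// sqrtr0 mulr0.
have L0 : 0 <= \sum_(1 <= tau < T.+1) l tau.
  by apply: (sum_nat1_ge0 (leqnSn T)) => t /l01 /andP[].
rewrite !(big_nat_recr T.+1)//=; have /andP[l0 l1] := l01 T.+1 (leqnn _).
apply: le_trans (lerD (IH _) (lexx _)) _.
  by move=> t /andP[t1 tT]; apply: l01; rewrite t1 leqW.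
move: (\sum_(1 <= tau < T.+1) l tau) L0 (l T.+1) l0 l1 => L L0 y y0 y1.
have L1 : 0 < Num.sqrt (L + 1) by rewrite sqrtr_gt0; lra.
have := @sqrt_step L (L + y) (Num.sqrt (L + 1)).
rewrite L0 L1 lerDl y0 ler_wsqrtr ?lerD2l// => /(_ isT isT isT).
rewrite sqrtrM ?(ltW c0)//.
rewrite sqrtrV; last by lra.
have -> : L + y - L = y by ring.
rewrite [Num.sqrt c * _ * y]mulrAC -[Num.sqrt c * y * _]mulrA;
  have := sqrtr_ge0 c.
move: (Num.sqrt c) (y / Num.sqrt (L + 1)) (Num.sqrt (L + y)) => r z u; nra.
Qed.

(** For the total loss [y], both [kap / eta T] and the sum of [eta t * l t] are at most multiples of
    [sqrt (y + 1)]; [B] adds up the factors, and [quadratic_regret] solves for [y]. *)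
Lemma adaptive_regret (l : nat -> R) (eta : nat -> R) c kap s0 B T :
  (1 <= T)%N ->
  (forall t, (1 <= t <= T)%N -> 0 <= l t <= 1) -> 0 < c -> 0 <= kap ->
    0 <= s0 ->
  (forall t, (1 <= t <= T)%N ->
     eta t = Num.sqrt (c / (\sum_(1 <= tau < t) l tau + 1))) ->
  \sum_(1 <= t < T.+1) (1 - eta t) * l t <= s0 + kap / eta T ->
  B = kap / Num.sqrt c + 2 * Num.sqrt c ->
  \sum_(1 <= t < T.+1) l t <= s0 + B * Num.sqrt s0 + B ^+ 2 + B.
Proof.
move=> T1 l01 c0 kap0 s00 etaE reg BE.
have L0 t : (t <= T)%N -> 0 <= \sum_(1 <= tau < t.+1) l tau.
  by move=> tT; apply: (sum_nat1_ge0 tT) => i /l01 /andP[].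
have c1 : 0 < Num.sqrt c by rewrite sqrtr_gt0.
apply: quadratic_regret => //;
  first by rewrite BE addr_ge0 ?divr_ge0 ?mulr_ge0 ?sqrtr_ge0.
  exact: L0.
have eq : \sum_(1 <= t < T.+1) l t = \sum_(1 <= t < T.+1) (1 - eta t) * l t +
    \sum_(1 <= t < T.+1) Num.sqrt (c / (\sum_(1 <= tau < t) l tau + 1)) * l t.
  rewrite -big_split /=; apply: eq_big_nat => t tT; rewrite etaE//; ring.
have := adaptive_rate_sum l01 c0.
have : kap / eta T <= kap / Num.sqrt c * Num.sqrt (\sum_(1 <=
  t < T.+1) l t + 1).
  rewrite etaE ?T1 ?leqnn// -mulrA ler_wpM2l//.
  have LT : 0 <= \sum_(1 <= tau < T) l tau by have := L0 T.-1 (leq_pred _);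
    rewrite prednK.
  rewrite sqrtrM ?(ltW c0)// sqrtrV; last by lra.
  rewrite invfM invrK; apply: ler_wpM2l; first by rewrite invr_ge0 ltW.
  apply: ler_wsqrtr; rewrite lerD2r.
  have /andP[lT _] := l01 T (introT andP (conj T1 (leqnn T))).
  by rewrite big_nat_recr// lerDl.
have : Num.sqrt (\sum_(1 <= t < T.+1) l t) <= Num.sqrt (\sum_(1 <=
  t < T.+1) l t + 1).
  by rewrite ler_wsqrtr// lerDl.
have c2 : 0 <= 2 * Num.sqrt c by rewrite mulr_ge0// ltW.
move=> /(ler_wpM2l c2) h1 h2 h3; rewrite BE mulrDl {1}eq; lra.
Qed.

(* Summation by parts: only the partial sums of [a] are controlled, by [B]. *)
Lemma abel_bound (a g B Phi : nat -> R) T : (1 <= T)%N ->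
  (forall t, (1 <= t < T)%N -> g t.+1 <= g t) -> 0 <= g T ->
  (forall t, (1 <= t <= T)%N -> \sum_(1 <= tau < t.+1) a tau <= B t) ->
  g 1%N * B 1%N <= Phi 1%N ->
  (forall t, (1 <= t < T)%N -> g t.+1 * (B t.+1 - B t) <= Phi t.+1 - Phi t) ->
  \sum_(1 <= t < T.+1) g t * a t <= Phi T.
Proof.
move=> T1 gS gT aB base step.
(* The induction carries the slack [B t] minus the partial sum, weighted by [g t]: it is
   nonnegative, so lowering the weight to [g t.+1] loses nothing, and at [T] it can be discarded. *)
suff claim t : (1 <= t <= T)%N -> \sum_(1 <= i < t.+1) g i * a i <=
    Phi t - g t * (B t - \sum_(1 <= i < t.+1) a i).
  have TT : (1 <= T <= T)%N by rewrite T1 leqnn.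
  have := claim T TT; have := aB T TT; nra.
elim: t => // -[_ _|t IH tT]; first by rewrite !big_nat1; lra.
have tT' : (1 <= t.+1 <= T)%N by apply: ltnW.
have := IH tT'; have := aB t.+1 tT'; have := gS t.+1 tT; have := step t.+1 tT.
rewrite !(big_nat_recr t.+2)//=.
move: (\sum_(1 <= i < t.+2) g i * a i) (\sum_(1 <= i < t.+2) a i) => x y; nra.
Qed.

End RateLemmas.

(** * Rates built from the losses of the competitors, as in (b2) *)

Section SelfConfident.
Context {R : realType}.
Implicit Types (x y : R) (T : nat).

Lemma sqrt2_bounds : [/\ Num.sqrt 2 ^+ 2 = 2 :> R, 7 / 5 <= Num.sqrt 2 :> R &
  Num.sqrt 2 <= 3 / 2 :> R].
Proof.
have e : Num.sqrt 2 ^+ 2 = 2 :> R by rewrite sqr_sqrtr.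
have := sqrtr_ge0 (2 : R); move: (Num.sqrt _) e => x e x0; split => //; nra.
Qed.

Let w x : R := Num.sqrt (Num.max 1 x).

Let w_ge1 x : 1 <= w x.
Proof. by rewrite -[leLHS]sqrtr1 ler_wsqrtr// le_max lexx. Qed.

(* The rate at time t+1 only knows the loss [x] before this step, not the loss
   [y] after it; the telescoping terms [1 / w] pay for the difference. *)
Let sqrt_potential x y : 0 <= x -> x <= y <= x + 1 ->
  (y - x) / w x <= 2 * (Num.sqrt y - Num.sqrt x) + (w x)^-1 - (w y)^-1.
Proof.
move=> x0 /andP[xy yx1].
have wx := w_ge1 x; have wy := w_ge1 y.
have wxy : (w y)^-1 <= (w x)^-1.
  rewrite lef_pV2 ?posrE ?(lt_le_trans ltr01)// /w ler_wsqrtr//.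
  by rewrite ge_max !le_max lexx xy orbT.
have : (y - x) / w y <= 2 * (Num.sqrt y - Num.sqrt x).
  apply: sqrt_step; rewrite ?x0//; last by apply: lt_le_trans wy.
  by rewrite ler_wsqrtr// le_max lexx orbT.
move: (w x)^-1 (w y)^-1 wxy => a b ab; nra.
Qed.

(** [1 + y <= 2 + x <= 3 * max 1 x], which reduces the claim to [ln_step]. *)
Let log_potential x y : 0 <= x -> x <= y <= x + 1 ->
  (y - x) / Num.max 1 x <= 3 * (ln (1 + y) - ln (1 + x)).
Proof.
move=> x0 /andP[xy yx1].
have y1 : 0 < 1 + y by lra.
have x1 : 0 < 1 + x by lra.
have := ln_step x1 y1.
have -> : 1 - (1 + x) / (1 + y) = (y - x) / (1 + y) by field; rewrite gt_eqF.
suff : (y - x) / Num.max 1 x <= 3 * ((y - x) / (1 + y)) by lra.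
have M1 : 1 <= Num.max 1 x by rewrite le_max lexx.
have Mx : x <= Num.max 1 x by rewrite le_max lexx orbT.
have M0 : 0 < Num.max 1 x by apply: lt_le_trans M1.
rewrite mulrCA; apply: ler_wpM2l; first lra.
by rewrite ler_pdivlMr// mulrC ler_pdivrMr//; lra.
Qed.

Section Lower.
Variables (K : R) (l m v : nat -> R) (T : nat).
Hypotheses (T1 : (1 <= T)%N) (K1 : 1 <= K) (m1 : m 1%N = 0)
  (mS : forall t, (1 <= t <= T)%N -> m t <= m t.+1 <= m t + 1)
  (vE : forall t, (1 <= t <= T)%N ->
     v t = Num.sqrt 2 * Num.max 1 (Num.sqrt (m t / K)))
  (reg : forall tau, (1 <= tau <= T)%N ->
     \sum_(1 <= t < tau.+1) (1 - (v t)^-1) * l t <= m tau.+1 + (K + 2) * v tau).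

Let m0 t : (t <= T)%N -> 0 <= m t.+1.
Proof.
elim: t => [|t IH] tT; first by rewrite m1.
by apply: le_trans (IH (ltnW tT)) _; case/andP: (@mS t.+1 tT).
Qed.

Let r : R := Num.sqrt K.
Let s2 : R := Num.sqrt 2.

Let s2_facts : [/\ s2 ^+ 2 = 2, 7 / 5 <= s2 & s2 <= 3 / 2] := sqrt2_bounds.

Let r_facts : 1 <= r /\ r ^+ 2 = K.
Proof.
split; last by rewrite /r sqr_sqrtr// (le_trans ler01 K1).
by rewrite -[leLHS]sqrtr1 ler_wsqrtr.
Qed.

Let v_facts t : (1 <= t <= T)%N ->
  [/\ 7 / 5 <= v t, Num.max 1 (m t) <= K / 2 * v t ^+ 2 &
      w (m t) <= r / s2 * v t].
Proof.
move=> tT; rewrite vE// -/s2; have [s2E s2l _] := s2_facts.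
have [r1 rE] := r_facts; have k1 := K1.
have mt0 : 0 <= m t by case: t tT => // t /andP[_ tT]; exact/m0/ltnW.
set M := Num.max 1 _.
have M1 : 1 <= M by rewrite le_max lexx.
have K0 : 0 < K by apply: lt_le_trans K1.
have KM : m t <= K * M ^+ 2.
  have : Num.sqrt (m t / K) <= M by rewrite le_max lexx orbT.
  have := sqrtr_ge0 (m t / K); have := sqr_sqrtr (divr_ge0 mt0 (ltW K0)).
  move: (Num.sqrt _) => z ez z0 zM.
  by rewrite mulrC -ler_pdivrMr// -ez; nra.
have mx : Num.max 1 (m t) <= K * M ^+ 2 by rewrite ge_max; apply/andP;
  split=> //; nra.
have e : K / 2 * (s2 * M) ^+ 2 = K * M ^+ 2 by rewrite exprMn s2E; field.
split; [nra | by rewrite e |].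
have -> : r / s2 * (s2 * M) = r * M by field; rewrite gt_eqF//; lra.
have -> : r * M = Num.sqrt (K * M ^+ 2).
  by rewrite -rE -exprMn sqrtr_sqr ger0_norm//; nra.
exact: ler_wsqrtr.
Qed.

(** Potential for [abel_bound]. The first two summands absorb the growth of the best loss [m], see
    [gain]; the last one absorbs the growth of [(K + 2) * v t], its constant 1 paying for the first
    step, where [v] equals [s2]. *)
Let Phi t : R := r / s2 * (2 * Num.sqrt (m t.+1) + 1 - (w (m t.+1))^-1) +
  6 * K * ln (1 + m t.+1) + 4 * (K + 2) * (1 + ln (v t) - ln s2).

Let g t : R := (v t - 1)^-1.

(** [g t] is [1 / v t] plus [1 / (v t * (v t - 1))]. The first part is of order [sqrt (K / m t)] and
    integrates to a square root, the second of order [K / m t] and integrates to a logarithm. *)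
Let gain t : (1 <= t <= T)%N -> g t * (m t.+1 - m t) <=
  r / s2 * (2 * (Num.sqrt (m t.+1) - Num.sqrt (m t)) +
    (w (m t))^-1 - (w (m t.+1))^-1) +
  6 * K * (ln (1 + m t.+1) - ln (1 + m t)).
Proof.
move=> tT; have [v75 vmax vw] := v_facts tT; have msT := mS tT.
have [s2E s2l _] := s2_facts; have [r1 rE] := r_facts; have k1 := K1.
have mt0 : 0 <= m t by case: t tT {v75 vmax vw msT} => // t /andP[_ tT];
  exact/m0/ltnW.
have mx1 : 1 <= Num.max 1 (m t) by rewrite le_max lexx.
have w1 := w_ge1 (m t).
have gv : g t <= r / s2 / w (m t) + 2 * K / Num.max 1 (m t).
  have -> : g t = (v t)^-1 + (v t * (v t - 1))^-1.
    by rewrite /g; field; rewrite !gt_eqF//; lra.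
  apply: lerD.
    rewrite ler_pdivlMr ?(lt_le_trans ltr01)// mulrC ler_pdivrMr//; lra.
  rewrite ler_pdivlMr ?(lt_le_trans ltr01)// mulrC ler_pdivrMr; last by nra.
  (* The last factor below is nonnegative from [v t = 4 / 3] on, and [v t >= 7 / 5] by the factor
     [sqrt 2] in the rate. *)
  apply: le_trans vmax _; rewrite -subr_ge0.
  have -> : 2 * K * (v t * (v t - 1)) - K / 2 * v t ^+ 2 =
    K * v t * (3 / 2 * v t - 2) by field.
  by rewrite !mulr_ge0//; lra.
have D0 : 0 <= m t.+1 - m t by case/andP: msT; lra.
apply: le_trans (ler_wpM2r D0 gv) _; rewrite mulrDl; apply: lerD.
  have -> : r / s2 / w (m t) * (m t.+1 - m t) = r / s2 * ((m t.+1 - m t) / w (m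
    t)).
    by field; rewrite !gt_eqF//; lra.
  by apply: ler_wpM2l (sqrt_potential mt0 msT); rewrite divr_ge0//; lra.
have -> : 2 * K / Num.max 1 (m t) * (m t.+1 - m t) =
    2 * K * ((m t.+1 - m t) / Num.max 1 (m t)).
  by field; rewrite gt_eqF//; lra.
have -> : 6 * K * (ln (1 + m t.+1) - ln (1 + m t)) =
  2 * K * (3 * (ln (1 + m t.+1) - ln (1 + m t))) by ring.
by apply: ler_wpM2l (log_potential mt0 msT); lra.
Qed.

Let g_le t : (1 <= t <= T)%N -> 0 < g t <= 4 / v t.
Proof.
move=> /v_facts[v75 _ _]; rewrite /g invr_gt0; apply/andP; split; first lra.
by rewrite ler_pdivlMr; [rewrite mulrC ler_pdivrMr|]; lra.
Qed.

Let v_nondecreasing t : (1 <= t < T)%N -> v t <= v t.+1.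
Proof.
move=> /andP[t1 tT]; have tT' : (1 <= t <= T)%N by rewrite t1 ltnW.
rewrite !vE// ?tT//; apply: ler_wpM2l; first exact: sqrtr_ge0.
rewrite ge_max !le_max lexx /= orbC ler_wsqrtr//; have k1 := K1.
by apply: ler_wpM2r; [rewrite invr_ge0; lra|case/andP: (mS tT')].
Qed.

Let v1 : v 1%N = s2.
Proof. by rewrite vE// m1 mul0r sqrtr0 max_l ?mulr1. Qed.

(** [v] follows [m], not [l], so the sum does not telescope in [l]. But [l t / v t] is [g t] times
    the term [(1 - 1 / v t) * l t], whose partial sums [reg] controls, and [g] is nonincreasing. *)
Let sum_rate_loss : \sum_(1 <= t < T.+1) (v t)^-1 * l t <= Phi T.
Proof.
have [s2E s2l _] := s2_facts; have [r1 rE] := r_facts; have k1 := K1.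
rewrite (eq_big_nat _ _ (F2 := fun t => g t * ((1 - (v t)^-1) * l t)));
  last first.
  move=> t /v_facts[v75 _ _]; rewrite mulrA; congr (_ * _); rewrite /g; field.
  by rewrite !gt_eqF//; lra.
apply: (abel_bound (B := fun t => m t.+1 + (K + 2) * v t)) => //.
- move=> t /[dup] tT /andP[t1 tT']; rewrite /g lef_pV2 ?posrE; last 2 first.
  + by have [] := v_facts (t := t.+1) tT'; lra.
  + by have [] := v_facts (t := t) _; [rewrite t1 ltnW|lra].
  by rewrite lerB// v_nondecreasing.
- have TT : (1 <= T <= T)%N by rewrite T1 leqnn.
  by have /andP[/ltW] := g_le TT.
- have g1 := gain (t := 1%N) T1; have /andP[g0 g4] := g_le (t := 1%N) T1.
  rewrite /Phi v1 -/s2; move: g1; rewrite m1 sqrtr0 /w max_l// sqrtr1 invr1.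
  rewrite addr0 ln1 !subr0.
  have : g 1%N * ((K + 2) * s2) <= 4 * (K + 2).
    have : g 1%N * s2 <= 4.
      rewrite -v1 -ler_pdivlMr//; rewrite v1; lra.
    nra.
  lra.
- move=> t /[dup] tT /andP[t1 tT'].
  have := gain (t := t.+1) tT'; have /andP[g0 g4] := g_le (t := t.+1) tT'.
  have [v75 _ _] := v_facts (t := t.+1) tT'.
  have [vt75 _ _] : [/\ 7 / 5 <= v t, Num.max 1 (m t) <= K / 2 * v t ^+ 2 &
      w (m t) <= r / s2 * v t] by apply: v_facts; rewrite t1 ltnW.
  have vv := v_nondecreasing tT.
  have : g t.+1 * (v t.+1 - v t) <= 4 * (ln (v t.+1) - ln (v t)).
    apply: (@le_trans _ _ (4 / v t.+1 * (v t.+1 - v t))).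
      by apply: ler_wpM2r g4; lra.
    have -> : 4 / v t.+1 * (v t.+1 - v t) = 4 * (1 - v t / v t.+1).
      by field; rewrite gt_eqF//; lra.
    by rewrite ler_pM2l//; apply: ln_step; lra.
  rewrite /Phi; move: (ln (v t.+1)) (ln (v t)) (ln s2) => a b c.
  have K2 : 0 <= K + 2 by lra.
  move=> /(ler_wpM2l K2); lra.
Qed.

(** The leading term arises in equal halves from [K * v T] and from the square root in [Phi T]. The
    term [3 * sqrt m] comes from [2 * v T], with [2 * sqrt 2 <= 3]. *)
Lemma class_self_confident : \sum_(1 <= t < T.+1) l t <=
  m T.+1 + 2 * Num.sqrt 2 * Num.sqrt K * Num.sqrt (m T.+1) +
  3 * Num.sqrt (m T.+1) + 18 * K * (1 + ln (1 + m T.+1)).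
Proof.
have TT : (1 <= T <= T)%N by rewrite T1 leqnn.
have [s2E s2l s2u] := s2_facts; have [r1 rE] := r_facts; have k1 := K1.
have mT0 := m0 (leqnn T).
have y0 := sqrtr_ge0 (m T.+1); have yE := sqr_sqrtr mT0.
rewrite -/r -/s2.
have -> : \sum_(1 <= t < T.+1) l t = \sum_(1 <= t < T.+1) (1 - (v t)^-1) * l t +
    \sum_(1 <= t < T.+1) (v t)^-1 * l t.
  by rewrite -big_split /=; apply: eq_big_nat => t _; ring.
apply: le_trans (lerD (reg TT) sum_rate_loss) _.
pose M := v T / s2.
have vM : v T = s2 * M by rewrite /M mulrC divfK// gt_eqF//; lra.
have ME : M = Num.max 1 (Num.sqrt (m T / K)).
  by rewrite /M vE// mulrAC divff ?mul1r// gt_eqF//; lra.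
have mTK : Num.sqrt (m T / K) <= Num.sqrt (m T.+1) / r.
  rewrite -sqrtrV; last lra.
  rewrite -sqrtrM// ler_wsqrtr// ler_wpM2r//; first by rewrite invr_ge0; lra.
  by case/andP: (mS TT).
have My : M <= 1 + Num.sqrt (m T.+1) / r.
  rewrite ME ge_max lerDl divr_ge0//=; last lra.
  by apply: le_trans mTK _; rewrite lerDr.
have M1 : 1 <= M by rewrite ME le_max lexx.
have yr : Num.sqrt (m T.+1) / r <= m T.+1 + 1.
  rewrite ler_pdivrMr; last lra.
  have : Num.sqrt (m T.+1) <= m T.+1 + 1 by nra.
  nra.
have lnM : ln (v T) - ln s2 <= ln (1 + m T.+1).
  rewrite -ln_div ?posrE; [|rewrite vM; nra|lra].
  rewrite -/M ler_ln ?posrE; [|lra|lra].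
  rewrite ME ge_max lerDl mT0 /=; apply: le_trans mTK _; lra.
have lam0 : 0 <= ln (1 + m T.+1) by apply: ln_ge0; lra.
have w0 : 0 <= (w (m T.+1))^-1 by rewrite invr_ge0 sqrtr_ge0.
rewrite /Phi vM; rewrite vM in lnM.
move: (ln (s2 * M)) (ln s2) (ln _) lnM lam0 => a b lam lnM lam0.
move: (w _)^-1 w0 => z z0.
have h1 : (K + 2) * (s2 * M) <= s2 * r * Num.sqrt (m T.+1) +
   2 * s2 * Num.sqrt (m T.+1) + (K + 2) * s2.
  have Mr : M * r <= r + Num.sqrt (m T.+1).
    by have := ler_wpM2r (le_trans ler01 r1) My;
      rewrite mulrDl mul1r divfK// gt_eqF//; lra.
  have s20 : 0 <= s2 by lra.
  suff : (K + 2) * M <= r * Num.sqrt (m T.+1) + 2 * Num.sqrt (m T.+1) + (K + 2).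
    by move=> /(ler_wpM2l s20); lra.
  rewrite -rE; have := ler_wpM2l (le_trans ler01 r1) Mr.
  have Mu : M <= 1 + Num.sqrt (m T.+1) by nra.
  lra.
have h2 : r / s2 * (2 * Num.sqrt (m T.+1) + 1 - z) <=
    s2 * r * Num.sqrt (m T.+1) + r.
  have -> : r / s2 = r * s2 / 2.
    by rewrite -[X in _ * _ / X]s2E; field; rewrite gt_eqF//; lra.
  have : 0 <= r * s2 * z by rewrite !mulr_ge0//; lra.
  have : r * s2 <= 2 * r by nra.
  lra.
have rK : r <= K by nra.
have K1l := ler_wpM2r lam0 K1.
nra.
Qed.

End Lower.
End SelfConfident.

Section MetaSelfConfident.
Context {R : realType} (l c : nat -> R) (T : nat).
Hypotheses (T1 : (1 <= T)%N) (c2 : forall t, (1 <= t <= T.+1)%N -> 2 <= c t)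
  (cS : forall t, (1 <= t <= T)%N -> c t <= c t.+1 <= c t + 1)
  (reg : forall tau, (1 <= tau <= T)%N ->
     \sum_(1 <= t < tau.+1) (1 - (c t)^-1) * l t <=
       c tau.+1 ^+ 2 / 2 + 2 * c tau.+1).

(** [c] is the inverse upper rate. By [cS], an increment of [B] is at most [c + 5 / 2] times that of
    [c], and [(c + 5 / 2) / (c - 1)] is at most its value [9 / 2] at [c = 2]. *)
Lemma meta_self_confident : \sum_(1 <= t < T.+1) (c t)^-1 * l t <=
  9 / 2 * c T.+1.
Proof.
pose g t : R := (c t - 1)^-1.
have c2' t : (1 <= t <= T)%N -> 2 <= c t by move=> /andP[t1 tT];
  rewrite c2// t1 leqW.
rewrite (eq_big_nat _ _ (F2 := fun t => g t * ((1 - (c t)^-1) * l t)));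
  last first.
  move=> t /c2' ct; rewrite mulrA; congr (_ * _); rewrite /g; field.
  by rewrite !gt_eqF//; lra.
apply: (abel_bound (B := fun t => c t.+1 ^+ 2 / 2 + 2 * c t.+1)
  (Phi := fun t => 9 / 2 * c t.+1)) => //.
- move=> t /andP[t1 tT]; have tT' : (1 <= t <= T)%N by rewrite t1 ltnW.
  have h1 := c2' _ tT'; have h2 := c2' t.+1 tT; have /andP[h3 _] := cS tT'.
  by rewrite /g lef_pV2 ?posrE; lra.
- have TT : (1 <= T <= T)%N by rewrite T1 leqnn.
  by have := c2' _ TT; rewrite /g invr_ge0; lra.
- have h1 := c2' 1%N T1; have /andP[h2 h3] := cS (t := 1%N) T1.
  have h4 : 0 < c 1%N - 1 by lra.
  rewrite /g mulrC ler_pdivrMr//; nra.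
- move=> t /andP[t1 tT].
  have h1 := c2' t.+1 tT; have /andP[h2 h3] := cS (t := t.+1) tT.
  have h4 : 0 < c t.+1 - 1 by lra.
  rewrite /g mulrC ler_pdivrMr//; nra.
Qed.

End MetaSelfConfident.

(** * Combining the two levels, and the O-terms *)

Section Envelopes.
Context {R : realType}.
Implicit Types K G s L be x y : R.

(** Everything of lower order is a multiple of [K * G]: 42 from [L], [7 * 23] from [be * sqrt L],
    [23 ^ 2] from [be ^ 2] and 46 from [2 * be], in total 778. *)
Lemma combine_levels K G s L be : 1 <= K -> 1 <= G -> 0 <= s -> 0 <= L ->
  0 <= be <= 23 * Num.sqrt K ->
  L <= s + 2 * Num.sqrt 2 * Num.sqrt K * Num.sqrt s + 3 * Num.sqrt s + 42 * K *
    G ->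
  L + be * Num.sqrt L + be ^+ 2 + 2 * be <=
  s + 2 * Num.sqrt 2 * Num.sqrt K * Num.sqrt s + (3 + be) * Num.sqrt s + 1000 *
    K * G.
Proof.
move=> K1 G1 s0 L0 /andP[b0 bK] hL.
have [_ s2l s2u] := @sqrt2_bounds R.
have K0 : 0 <= K by lra.
have KG0 : 0 <= K * G by rewrite mulr_ge0//; lra.
set p := Num.sqrt (K * G); set r := Num.sqrt K in bK hL *.
have pE : p ^+ 2 = K * G by rewrite sqr_sqrtr.
have rE : r ^+ 2 = K by rewrite sqr_sqrtr.
have rp : r <= p by apply: ler_wsqrtr; nra.
have r1 : 1 <= r by rewrite -[leLHS]sqrtr1; exact: ler_wsqrtr.
have sE := sqr_sqrtr s0; have sq0 := sqrtr_ge0 s.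
(* The square of the right-hand side has [14 * p] before [sqrt s] and [49 * p ^ 2]; the bound on [L]
   needs only [6 * p] and [42 * p ^ 2]. *)
have LX : Num.sqrt L <= Num.sqrt s + 7 * p.
  have -> : Num.sqrt s + 7 * p = Num.sqrt ((Num.sqrt s + 7 * p) ^+ 2).
    by rewrite sqrtr_sqr ger0_norm//; lra.
  apply: ler_wsqrtr; apply: le_trans hL _.
  have : 2 * Num.sqrt 2 * r <= 3 * p by nra.
  move/(ler_wpM2r sq0) => h1.
  have h2 : 3 * Num.sqrt s <= 3 * p * Num.sqrt s.
    by apply: ler_wpM2r => //; lra.
  have : 0 <= p * Num.sqrt s by rewrite mulr_ge0//; lra.
  lra.
have h1 := ler_wpM2l b0 LX.
have h2 : be * p <= 23 * (K * G).
  apply: le_trans (ler_wpM2r _ bK) _; first by lra.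
  by rewrite -pE; nra.
have h3 : be ^+ 2 <= 529 * (K * G).
  have : be ^+ 2 <= (23 * p) ^+ 2 by rewrite ler_sqr ?nnegrE; lra.
  by rewrite exprMn pE; lra.
have h4 : be <= 23 * (K * G) by rewrite -pE; nra.
lra.
Qed.

(** [15 + 4 * ln K] is [2 * meta_complexity K + 14], the factor of [sqrt S] allowed in the meta
    regret. *)
Lemma meta_weight_bound K : 1 <= K ->
  0 <= 15 + 4 * ln K <= 23 * Num.sqrt K.
Proof.
move=> K1; have l0 : 0 <= ln K by exact: ln_ge0.
have K0 : 0 <= K by lra.
have r1 : 1 <= Num.sqrt K by rewrite -[leLHS]sqrtr1; exact: ler_wsqrtr.
have : ln K <= 2 * (Num.sqrt K - 1).
  rewrite -{1}(sqr_sqrtr K0) lnXn; last by lra.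
  by have := @ln_le_subr1 _ (Num.sqrt K); rewrite mulr2n; lra.
by move=> h; apply/andP; split; lra.
Qed.

(* The class of an expert of complexity [x] has index [K <= x + 1], and the
   regret is [2 sqrt (2 s K) + O((1 + ln K) sqrt s)]. *)
Definition envelope x : R :=
  (Num.sqrt (x + 1) + 2 * ln (x + 1) + 7) / Num.sqrt x - 1.

Lemma envelope_bound K x s : 1 <= K -> K <= x + 1 -> 0 < x -> 0 <= s ->
  2 * Num.sqrt 2 * Num.sqrt K * Num.sqrt s + (18 + 4 * ln K) * Num.sqrt s <=
  2 * Num.sqrt (2 * s * x) * (1 + envelope x).
Proof.
move=> K1 Kx x0 s0; have [_ s2l s2u] := @sqrt2_bounds R.
have sx : 0 < Num.sqrt x by rewrite sqrtr_gt0.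
have -> : Num.sqrt (2 * s * x) = Num.sqrt 2 * Num.sqrt s * Num.sqrt x.
  by rewrite sqrtrM ?mulr_ge0// sqrtrM.
have -> : 2 * (Num.sqrt 2 * Num.sqrt s * Num.sqrt x) * (1 + envelope x) =
   2 * Num.sqrt 2 * (Num.sqrt (x + 1) + 2 * ln (x + 1) + 7) * Num.sqrt s.
  by rewrite /envelope; field; rewrite gt_eqF.
rewrite -mulrDl; apply: ler_wpM2r; first exact: sqrtr_ge0.
have : Num.sqrt K <= Num.sqrt (x + 1) by apply: ler_wsqrtr.
have : ln K <= ln (x + 1) by rewrite ler_ln ?posrE; lra.
have : 0 <= ln K by exact: ln_ge0.
have s20 : 0 <= Num.sqrt 2 :> R by lra.
move=> h1 h2 /(ler_wpM2l s20) h3.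
(* The 7 in [envelope] suffices: [2 * 7 / 5 * 7] exceeds 18, and [2 * 7 / 5 * 2] exceeds 4. *)
have : 7 / 5 * (2 * ln (x + 1) + 7) <= Num.sqrt 2 * (2 * ln (x + 1) + 7).
  by apply: ler_wpM2r => //; lra.
lra.
Qed.

Lemma ln_shift x : 1 <= x -> ln (x + 1) <= 1 + ln x.
Proof.
move=> x1; have : ln (x + 1) <= ln (2 * x) by rewrite ler_ln ?posrE; lra.
rewrite lnM ?posrE; [|lra|lra].
by have := @ln_le_subr1 R 2; lra.
Qed.

Lemma envelope_bigO (k0 : R) : 1 < k0 ->
  bigO_on `[k0, +oo[ envelope (fun x => ln x / Num.sqrt x).
Proof.
move=> k1; have lk0 : 0 < ln k0 by exact: ln_gt0.
(* The 10 is 1 for the difference of the two roots, 2 from doubling [ln_shift], and 7 from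
   [envelope]; [ln x >= ln k0] turns it into a multiple of [ln x]. *)
exists (10 / ln k0 + 2) => x; rewrite /= in_itv /= andbT => kx.
have lx : ln k0 <= ln x by rewrite ler_ln ?posrE; lra.
have x0 : 0 <= x by lra.
have sx : 0 < Num.sqrt x by rewrite sqrtr_gt0; lra.
have -> : envelope x =
    (Num.sqrt (x + 1) - Num.sqrt x + 2 * ln (x + 1) + 7) / Num.sqrt x.
  by rewrite /envelope; field; rewrite gt_eqF.
have sxx : Num.sqrt x <= Num.sqrt (x + 1) by apply: ler_wsqrtr; lra.
have sx1 : Num.sqrt (x + 1) <= Num.sqrt x + 1.
  have -> : Num.sqrt x + 1 = Num.sqrt ((Num.sqrt x + 1) ^+ 2).
    by rewrite sqrtr_sqr ger0_norm//; lra.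
  by apply: ler_wsqrtr; rewrite sqrrD sqr_sqrtr//; lra.
have l1 : 0 <= ln (x + 1) by apply: ln_ge0; lra.
have lsh := @ln_shift x _.
rewrite !normrM !normfV (ger0_norm (ltW sx)) !ger0_norm; [|lra|lra].
rewrite mulrA; apply: ler_wpM2r; first by rewrite invr_ge0 ltW.
have : 10 <= 10 / ln k0 * ln x.
  by rewrite mulrAC ler_pdivlMr//; lra.
have := lsh; lra.
Qed.

Lemma remainder_bigO (k0 : R) : 0 < k0 ->
  bigO_on `[k0, +oo[ (fun x => 1000 * (x + 1)) (fun x => x).
Proof.
move=> k00; exists (1000 * (1 + 1 / k0)) => x; rewrite /= in_itv /= andbT => kx.
rewrite !ger0_norm; [|lra|lra].
have : 1 <= 1 / k0 * x by rewrite mulrAC mul1r ler_pdivlMr//; lra.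
lra.
Qed.

Lemma log_remainder_bigO (k0 L0 : R) : 0 < k0 -> 1 < L0 ->
  bigO_on (`[k0, +oo[ `*` `[L0, +oo[)
    (fun z : R * R => 1000 * (z.1 + 1) * (1 + ln (1 + z.2))) (fun z =>
      z.1 * ln z.2).
Proof.
move=> k00 L01; have lL0 : 0 < ln L0 by exact: ln_gt0.
exists (1000 * (1 + 1 / k0) * (2 / ln L0 + 1)) => -[x L] /=.
rewrite !in_itv /= !andbT => -[kx LL].
have lL : ln L0 <= ln L by rewrite ler_ln ?posrE; lra.
have lsh := @ln_shift L _; rewrite [L + 1]addrC in lsh.
have lsh' : ln (1 + L) <= 1 + ln L by apply: lsh; lra.
have l1 : 0 <= ln (1 + L) by apply: ln_ge0; lra.
have xk : x + 1 <= (1 + 1 / k0) * x.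
  have : 1 <= 1 / k0 * x by rewrite mulrAC mul1r ler_pdivlMr//; lra.
  lra.
have lk : 1 + ln (1 + L) <= (2 / ln L0 + 1) * ln L.
  have : 2 <= 2 / ln L0 * ln L by rewrite mulrAC ler_pdivlMr//; lra.
  lra.
have ge1 : 0 <= 1000 * (x + 1) * (1 + ln (1 + L)) by apply: mulr_ge0; lra.
have ge2 : 0 <= x * ln L by apply: mulr_ge0; lra.
rewrite (ger0_norm ge1) (ger0_norm ge2).
have -> : 1000 * (1 + 1 / k0) * (2 / ln L0 + 1) * (x * ln L) =
  1000 * (((1 + 1 / k0) * x) * ((2 / ln L0 + 1) * ln L)) by ring.
have : (x + 1) * (1 + ln (1 + L)) <=
    (1 + 1 / k0) * x * ((2 / ln L0 + 1) * ln L) by apply: ler_pM => //; lra.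
lra.
Qed.

End Envelopes.

(** * The hierarchical algorithm *)

Lemma mutually_independent_restrict (R : realType) (d : measure_display)
    (Omega : measurableType d) (P : probability Omega R) (I J : choiceType)
    (D : set I) (A : set J) (X : I -> {RV P >-> R}) (f : J -> I) (g : I -> J) :
  cancel f g -> (forall j, A j -> D (f j)) ->
  mutually_independent D X -> mutually_independent A (X \o f).
Proof.
move=> fK AD ind L E LA mE.
have := ind [fset f j | j in L]%fset (E \o g); rewrite big_imfset /=;
  last first.
  by move=> i j _ _ /(can_inj fK).
under eq_bigr do rewrite /= fK.
move=> <-; last first.
- by move=> j; exact: mE.
- by move=> i /imfsetP[j /= jL ->]; apply: AD; exact: LA.
congr (P _); apply/seteqP; split => w /= h i.
  by move=> /imfsetP[j /= jL ->]; rewrite /= fK; exact: h.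
by move=> iL; have := h (f i); rewrite /= fK; apply; apply: in_imfset.
Qed.

Lemma meta_complexity_ge {R : realType} K : (1 <= K)%N ->
  1 / 2 <= meta_complexity K :> R.
Proof.
by move=> K1; rewrite /meta_complexity lerDl mulr_ge0// ln_ge0// ler1n.
Qed.

Lemma meta_weight {R : realType} K : (1 <= K)%N ->
  expR (- meta_complexity K) <= (K%:R ^- 2) :> R.
Proof.
move=> K1; have K0 : 0 < K%:R :> R by rewrite ltr0n.
have -> : - meta_complexity K = - (1 / 2) + (- ln K%:R - ln K%:R) :> R.
  rewrite /meta_complexity; ring.
rewrite expRD -[leRHS]mul1r; apply: ler_pM; rewrite ?expR_ge0//.
by rewrite expRD expRN lnK ?posrE// expr2 invfM.
Qed.

(** By [meta_weight] the terms are at most [K^-2], and [1 / (N + 1)^2 <= 1 / N - 1 / (N + 1)]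
    telescopes to 2. Hence the value 2 in the Kraft hypotheses above. *)
Lemma meta_kraft (R : realType) n (k : nat -> R) :
  (\sum_(j <oo | j \in active_classes n k) (expR (- meta_complexity j : R))%:E
     <= 2%:E)%E.
Proof.
have partial N : (1 <= N)%N -> \sum_(0 <= j < N.+1 | j \in active_classes n k)
    expR (- meta_complexity j : R) <= 2 - N%:R^-1.
  have step j : (1 <= j)%N -> (if j \in active_classes n k then
      expR (- meta_complexity j : R) else 0) <= j%:R ^- 2.
    by move=> j1; case: ifP => _;
      [exact: meta_weight|rewrite invr_ge0 exprn_ge0].
  elim: N => // -[_ _|N IH _].
    rewrite big_mkcond /= !big_nat_recl//= big_geq// memNset => [|[]//].
    have := step 1%N isT; rewrite expr1n invr1; lra.
  rewrite big_mkcond big_nat_recr//= -big_mkcond /=.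
  apply: le_trans (lerD (IH isT) (step N.+2 isT)) _.
  have : (N.+2%:R : R) ^- 2 <= N.+1%:R^-1 - N.+2%:R^-1.
    have N1 : 0 < N.+1%:R :> R by rewrite ltr0n.
    rewrite -[N.+2]addn1 natrD; move: (N.+1%:R : R) N1 => x x0.
    have -> : x^-1 - (x + 1)^-1 = (x * (x + 1))^-1.
      by field; rewrite !gt_eqF//; lra.
    by rewrite lef_pV2 ?posrE ?exprn_gt0 ?mulr_gt0//; nra.
  move: (N.+2%:R ^- 2 : R) (N.+1%:R^-1 : R) (N.+2%:R^-1 : R) => x y z; lra.
apply: lime_le; first by apply: is_cvg_nneseries_cond => j _ _;
  rewrite lee_fin expR_ge0.
near=> N; rewrite sumEFin lee_fin.
have N1 : (1 < N)%N by near: N; exact: nbhs_infty_gt.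
rewrite -(prednK (ltnW N1)); apply: le_trans (partial N.-1 _) _.
  by rewrite -ltnS prednK// ltnW.
by rewrite lerBlDr lerDl invr_ge0.
Unshelve. all: by end_near. Qed.

Section HierarchyMeasurability.
Context {R : realType} (n : option nat) (k : nat -> R)
  (s eta : nat -> nat -> R) {d : measure_display} {Z : measurableType d}
  (x y : nat -> Z -> R) (e : nat -> Z -> R).
Hypothesis mx : forall i, experts n i -> measurable_fun setT (x i).

(** The space [Z] is general because these facts are used on [Omega], with a frozen constant [x], on
    the sigma-algebra of [q], and on the product of two sigma-algebras. *)
Lemma measurable_fpl_select K t :
  measurable_fun setT (fun z => fpl_select n k s eta (x^~ z) K t).
Proof.
apply: (measurable_argmin (F := fun i z =>
  past_loss s i t + (k i - x i z) / eta K t)).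
move=> i [ni _]; apply: measurable_funD => //; apply: measurable_funM => //.
by apply: measurable_funB => //; exact: mx.
Qed.

Lemma measurable_fpl_loss K t :
  measurable_fun setT (fun z => fpl_loss n k s eta (x^~ z) K t).
Proof.
exact: (measurable_fun_select (f := fun i _ =>
  s t i) (measurable_fpl_select K t)).
Qed.

Lemma measurable_fpl_past_loss K t :
  measurable_fun setT (fun z => fpl_past_loss n k s eta (x^~ z) K t).
Proof. by apply: measurable_sum => tau; exact: measurable_fpl_loss. Qed.

(** The infimum over countably many classes is below [a] exactly when some member is, a countable
    union of events. *)
Lemma measurable_meta_min_scale t : active_classes n k !=set0 ->
  measurable_fun setT (fun z => meta_min_scale n k s eta (x^~ z) t).
Proof.
move=> [K0 aK0].
pose h K z := meta_complexity K +
  Num.sqrt (meta_complexity K ^+ 2 + 2 * fpl_past_loss n k s eta (x^~ z) K t +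
    2).
have mh K : measurable_fun setT (h K).
  apply: measurable_funD => //; apply: measurableT_comp.
    by apply: nondecreasing_measurable => // a b; exact: ler_wsqrtr.
  do 2 apply: measurable_funD => //.
  by apply: measurable_funM => //; exact: measurable_fpl_past_loss.
move=> mD; apply: (measurability _ (RGenInftyO.measurableE R)) => //.
move=> _ [_ [a ->] <-]; rewrite setTI.
rewrite [X in measurable X](_ : _ =
    \bigcup_(K in active_classes n k) [set z | h K z < a]).
  by apply: bigcup_measurable => K _; exact: measurable_lt.
have hS z : has_inf [set h K z | K in active_classes n k].
  split; first by exists (h K0 z), K0.
  exists 0 => _ [K [K1 _] <-]; rewrite /h addr_ge0 ?sqrtr_ge0//.
  by rewrite (le_trans _ (meta_complexity_ge K1)).
apply/seteqP; split => z /=; rewrite in_itv /=.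
  by move/(inf_lt (hS z).1) => [_ [K aK <-] ha]; exists K.
move=> [K aK /=]; apply: le_lt_trans; apply: ge_inf; last by exists K.
by case: (hS z).
Qed.

Hypothesis my : forall K, active_classes n k K -> measurable_fun setT (y K).

(** The rate enters the scores through its inverse, which is also the expression that the rates of
    (b1) and (b2) provide directly. *)
Lemma measurable_hfpl_loss t : measurable_fun setT (fun z => (e t z)^-1) ->
  measurable_fun setT
    (fun z => s t (hfpl_select n k s eta (e^~ z) (x^~ z) (y^~ z) t)).
Proof.
move=> me; have mm : measurable_fun setT
    (fun z => meta_select n k s eta (e^~ z) (x^~ z) (y^~ z) t).
  apply: (measurable_argmin (F := fun K z =>
    fpl_past_loss n k s eta (x^~ z) K t + (meta_complexity K - y K z) / e t z)).
  move=> K aK; apply: measurable_funD; first exact: measurable_fpl_past_loss.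
  by apply: measurable_funM => //; apply: measurable_funB => //; exact: my.
exact: (measurable_fun_select (f := fun K z => fpl_loss n k s eta (x^~ z) K t)
  mm (measurable_fpl_loss^~ t)).
Qed.

End HierarchyMeasurability.

Arguments measurable_fpl_loss {R n k s eta d Z x} mx K t.
Arguments measurable_fpl_past_loss {R n k s eta d Z x} mx K t.
Arguments measurable_hfpl_loss {R n k s eta d Z x y e} mx my t.
Arguments measurable_meta_min_scale {R n k s eta d Z x} mx t.

Section Hierarchy.
Context {R : realType} (n : option nat) (k : nat -> R) (T : nat)
  (s : nat -> nat -> R) {d : measure_display} {Omega : measurableType d}
  (P : probability Omega R) (q qt : nat -> {RV P >-> R}).
Hypotheses (n0 : n != Some 0%N) (k0 : forall i, experts n i -> 0 <= k i)
  (kraft : (\esum_(i in experts n) (expR (- k i))%:E <= 1)%E) (T1 : (1 <= T)%N)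
  (s01 : forall t i, (1 <= t <= T)%N -> experts n i -> 0 <= s t i <= 1)
  (ind : mutually_independent (perturbation_index n) (perturbations q qt))
  (expq : forall j, perturbation_index n j ->
     exponentially_distributed (perturbations q qt j)).

Lemma experts1 : experts n 1%N.
Proof. by move: n0; case: n => [[|m]|]. Qed.

Lemma class_experts K i : complexity_class n k K i -> experts n i.
Proof. by case. Qed.

Lemma class_ceil_le K i : complexity_class n k K i -> k i <= K%:R.
Proof. by move=> [_ e]; have := ceil_ge (k i); rewrite e. Qed.

Lemma independent_q A : A `<=` experts n -> mutually_independent A q.
Proof.
move=> An; rewrite -[q]/(perturbations q qt \o inl).
pose g (x : nat + nat) := match x with inl i => i | inr i => i end.
by apply: (@mutually_independent_restrict _ _ _ _ _ _ _ _ _ _ g _ _ ind).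
Qed.

Lemma independent_qt : mutually_independent (active_classes n k) qt.
Proof.
rewrite -[qt]/(perturbations q qt \o inr).
pose g (x : nat + nat) := match x with inl i => i | inr i => i end.
by apply: (@mutually_independent_restrict _ _ _ _ _ _ _ _ _ _ g _ _ ind) =>
  // j [].
Qed.

Lemma class_kraft K :
  (\sum_(j <oo | j \in complexity_class n k K) (expR (- k j))%:E <= 2%:E)%E.
Proof.
have : (\sum_(j <oo | j \in complexity_class n k K) (expR (- k j))%:E <= 1)%E.
  apply: le_trans kraft.
  have -> : experts n = [set j | j \in experts n].
    by apply/seteqP; split => j; rewrite /= inE.
  rewrite -nneseries_esum; last by move=> j _; rewrite lee_fin expR_ge0.
  apply: subset_lee_nneseries => j; rewrite ?inE;
    first by rewrite lee_fin expR_ge0.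
  exact: class_experts.
by move=> /le_trans; apply; rewrite lee_fin ler1n.
Qed.

Variables (eta : nat -> nat -> R) (etat : nat -> Omega -> R).

Lemma fpl_loss01 x K t : (1 <= t <= T)%N -> 0 <= fpl_loss n k s eta x K t <= 1.
Proof.
move=> tT; rewrite /fpl_loss /fpl_select; set F := fun i => _.
by apply: s01 => //; case: (argmin_in (complexity_class n k K) F) =>
  [/class_experts//|->]; exact: experts1.
Qed.

Lemma fpl_past_loss_ge0 x K t : (t <= T.+1)%N ->
  0 <= fpl_past_loss n k s eta x K t.
Proof.
move=> tT; rewrite /fpl_past_loss big_nat_cond sumr_ge0// =>
  i /andP[/andP[i1 it] _].
by have /andP[] : 0 <= fpl_loss n k s eta x K i <= 1
  by apply: fpl_loss01; rewrite i1 -ltnS (leq_trans it).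
Qed.

Let mq i : measurable_fun setT (q i : Omega -> R).
Proof. exact: measurable_funPT. Qed.

Definition class_loss (K t : nat) : R :=
  fine 'E_P[fun w => fpl_loss n k s eta (q ^~ w) K t].

Lemma class_lossE K t : (1 <= t <= T)%N ->
  (class_loss K t)%:E = ('E_P[fun w => fpl_loss n k s eta (q ^~ w) K t])%E /\
  0 <= class_loss K t <= 1.
Proof.
move=> tT; apply: fine_expectation => [|w]; last exact: fpl_loss01.
exact: (measurable_fpl_loss (x := fun i w => q i w) (fun i _ => mq i)).
Qed.

Lemma class_regret K i tau : complexity_class n k K i -> (1 <= tau <= T)%N ->
  (forall t, (1 <= t <= tau)%N -> 0 < eta K t) ->
  (forall t, (1 <= t < tau)%N -> eta K t.+1 <= eta K t) ->
  \sum_(1 <= t < tau.+1) (1 - eta K t) * class_loss K t <=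
  past_loss s i tau.+1 + (K%:R + 2) / eta K tau.
Proof.
move=> Ki /andP[tau1 tauT] eta0 etaS.
have indq : mutually_independent (complexity_class n k K) q.
  by apply: independent_q => j; exact: class_experts.
have expK j : complexity_class n k K j -> exponentially_distributed (q j).
  by move=> /class_experts nj; exact: (expq (j := inl j)).
apply: le_trans (fpl_regret indq expK _ (class_kraft K) (u := s)
  (eta := eta K) tau1 Ki _ eta0 etaS) _.
- by move=> j /class_experts; exact: k0.
- move=> t j /andP[t1 ttau] jK; apply: s01.
    by rewrite t1 (leq_trans ttau).
  by case: jK => [/class_experts//|->]; exact: experts1.
- rewrite lerD2l ler_pM2r ?invr_gt0 ?eta0 ?tau1 ?leqnn//.
  by rewrite lerD2r (class_ceil_le Ki).
Qed.

(** For rates that are functions of [q], a version of the conditional expectation of the loss given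
    [q]; [meta_past_expected_loss] is a sum of such terms. *)
Definition meta_loss (t : nat) (w : Omega) : R :=
  fine 'E_P[fun w' => s t (hfpl_select n k s eta (etat ^~ w) (q ^~ w) (qt ^~
    w') t)].

Let mqt i : measurable_fun setT (qt i : Omega -> R).
Proof. exact: measurable_funPT. Qed.

Lemma hfpl_loss01 e x y t : (1 <= t <= T)%N ->
  0 <= s t (hfpl_select n k s eta e x y t) <= 1.
Proof. exact: fpl_loss01. Qed.

Lemma meta_lossE t w : (1 <= t <= T)%N -> (meta_loss t w)%:E = ('E_P[fun w' =>
    s t (hfpl_select n k s eta (etat ^~ w) (q ^~ w) (qt ^~ w') t)])%E /\
  0 <= meta_loss t w <= 1.
Proof.
move=> tT; apply: fine_expectation => [|w']; last exact: fpl_loss01.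
exact: (measurable_hfpl_loss (x := fun i _ => q i w) (y := fun i w' => qt i w')
  (e := fun t _ => etat t w) (fun i _ => measurable_cst _) (fun i _ => mqt i) t
  (measurable_cst _)).
Qed.

Lemma meta_regret w K tau : active_classes n k K -> (1 <= tau <= T)%N ->
  (forall t, (1 <= t <= tau)%N -> 0 < etat t w) ->
  (forall t, (1 <= t < tau)%N -> etat t.+1 w <= etat t w) ->
  \sum_(1 <= t < tau.+1) (1 - etat t w) * meta_loss t w <=
  fpl_past_loss n k s eta (q ^~ w) K tau.+1 +
    (meta_complexity K + 2) / etat tau w.
Proof.
move=> aK /andP[tau1 tauT] eta0 etaS.
have expK j : active_classes n k j -> exponentially_distributed (qt j).
  by move=> [j1 _]; exact: (expq (j := inr j)).
apply: (fpl_regret independent_qt expK _ (@meta_kraft R n k)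
  (u := fun t K => fpl_loss n k s eta (q ^~ w) K t)
  (eta := etat ^~ w) tau1 aK _ eta0 etaS).
- by move=> j [j1 _]; apply: le_trans (meta_complexity_ge j1); lra.
- by move=> t j /andP[t1 ttau] _; apply: fpl_loss01;
  rewrite t1 (leq_trans ttau).
Qed.

Definition lower_index : set (nat + nat) :=
  [set x | if x is inl i then experts n i else False].

Definition upper_index : set (nat + nat) :=
  [set x | if x is inr K then (1 <= K)%N else False].

Let X := perturbations q qt.

Let F (t : nat) (z : sigma_of lower_index X * sigma_of upper_index X) : \bar R
  :=
  (if `[< (1 <= t <= T)%N >] then s t (hfpl_select n k s eta
    (etat ^~ z.1) (q ^~ z.1) (qt ^~ z.2) t) else 0)%:E.

Let F0 t z : (0 <= F t z)%E.
Proof.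
rewrite lee_fin; case: asboolP => // tT.
by case/andP: (hfpl_loss01 (etat ^~ z.1) (q ^~ z.1) (qt ^~ z.2) tT).
Qed.

Let mF t : ((1 <= t <= T)%N ->
    measurable_fun setT (fun w : sigma_of lower_index X => (etat t w)^-1)) ->
  measurable_fun setT (F t).
Proof.
move=> me; apply/measurable_EFinP; case: asboolP => // tT.
pose Z : measurableType _ :=
  (sigma_of lower_index X * sigma_of upper_index X)%type.
have mx i : experts n i -> measurable_fun setT (fun z : Z => q i z.1).
  move=> ni.
  by apply: (measurableT_comp (@measurable_fun_coord _ _ _ _ _ lower_index X
    (inl i) _)).
have my K : active_classes n k K -> measurable_fun setT (fun z : Z => qt K z.2).
  move=> [K1 _].
  by apply: (measurableT_comp (@measurable_fun_coord _ _ _ _ _ upper_index X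
    (inr K) _)).
apply: (measurable_hfpl_loss (e := fun t (z : Z) => etat t z.1) mx my t).
exact: (measurableT_comp (me tT)).
Qed.

(** Only the rate at the same time [t] is involved, so this fits the recursion of (b1), where each
    rate is computed from earlier meta losses. *)
Lemma measurable_meta_loss t : (1 <= t <= T)%N ->
  measurable_fun setT (fun w : sigma_of lower_index X => (etat t w)^-1) ->
  measurable_fun setT (meta_loss t : sigma_of lower_index X -> R).
Proof.
move=> tT me; apply/measurable_EFinP.
have := measurable_inner_integral (mF (fun=> me)) (@F0 t).
congr measurable_fun; apply/funext => w /=.
rewrite (meta_lossE w tT).1 expectationE; apply: eq_integral => w' _.
by rewrite /F asboolT.
Qed.

Section MeasurableRates.
Hypothesis metat : forall t, (1 <= t <= T)%N ->
  measurable_fun setT (fun w : sigma_of lower_index X => (etat t w)^-1).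

(** [freezing] for the pair of families [q] and [qt]; it applies because the rates are measurable
    for the sigma-algebra of [q], not merely on [Omega]. *)
Lemma hfpl_expected_lossE : hfpl_expected_loss n k s q qt eta etat T =
  (\int[P]_w (\sum_(1 <= t < T.+1) meta_loss t w)%:E)%E.
Proof.
have D1D : lower_index `<=` perturbation_index n by case.
have D2D : upper_index `<=` perturbation_index n by case.
have D12 : lower_index `&` upper_index = set0.
  by apply/seteqP; split => -[i|i] //= [].
have mF' t : (1 <= t <= T)%N -> measurable_fun setT (F t) by move=> tT;
  apply: mF => _; exact: metat.
pose G t z := if `[< (1 <= t <= T)%N >] then F t z else 0%E.
have mG t : measurable_fun setT (G t).
  by rewrite /G; case: asboolP => // tT; exact: mF'.
have G0 t z : (0 <= G t z)%E by rewrite /G; case: asboolP.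
have GE t z : (1 <= t <= T)%N -> G t z = (s t (hfpl_select n k s eta
    (etat ^~ z.1) (q ^~ z.1) (qt ^~ z.2) t))%:E.
  by move=> tT; rewrite /G /F asboolT.
rewrite /hfpl_expected_loss expectationE.
transitivity (\int[P]_w \sum_(1 <= t < T.+1) G t (w, w))%E.
  apply: eq_integral => w _; rewrite -sumEFin; apply: eq_big_nat => t tT.
  by rewrite GE.
pose H z := (\sum_(1 <= t < T.+1) G t z)%E.
have mH : measurable_fun setT H by exact: emeasurable_sum.
have H0 z : (0 <= H z)%E by exact: sume_ge0.
have := freezing mH H0 ind D1D D2D D12; rewrite /H => ->.
apply: eq_integral => w _.
rewrite ge0_integral_sum//; last first.
  move=> t; apply: measurableT_comp (mG t) _; apply: measurable_fun_pair => //.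
  exact: measurable_fun_to_sigma_of.
rewrite -sumEFin; apply: eq_big_nat => t tT.
rewrite (meta_lossE w tT).1 expectationE; apply: eq_integral => w' _.
by rewrite GE.
Qed.

(** An affine bound integrates over [q] at once, as [fpl_past_loss] has expectation
    [fpl_past_expected_loss]. *)
Lemma hfpl_expected_loss_le K b c : 0 <= b -> 0 <= c ->
  (forall w, \sum_(1 <= t < T.+1) meta_loss t w <=
     b * fpl_past_loss n k s eta (q ^~ w) K T.+1 + c) ->
  (hfpl_expected_loss n k s q qt eta etat T <=
   (b * fpl_past_expected_loss n k s q eta K T.+1 + c)%:E)%E.
Proof.
move=> b0 c0 le; rewrite hfpl_expected_lossE.
have mS : measurable_fun setT (fun w =>
  fpl_past_loss n k s eta (q ^~ w) K T.+1).
  exact: (measurable_fpl_past_loss (x := fun i w => q i w) (fun i _ => mq i)).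
have S0 w : 0 <= fpl_past_loss n k s eta (q ^~ w) K T.+1.
  exact: fpl_past_loss_ge0.
have mm : measurable_fun setT (fun w : Omega =>
  \sum_(1 <= t < T.+1) meta_loss t w).
  rewrite (_ : (fun w => _) = (fun w => \sum_(1 <= t < T.+1)
      if `[< (1 <= t <= T)%N >] then meta_loss t w else 0)); last first.
    by apply/funext => w; apply: eq_big_nat => t tT; rewrite asboolT.
  apply: measurable_sum => t; case: asboolP => // tT.
  by apply: (@measurable_fun_sigma_of _ _ _ P _ lower_index X);
    exact: measurable_meta_loss (metat tT).
apply: (@le_trans _ _ (\int[P]_w (b%:E *
    (fpl_past_loss n k s eta (q ^~ w) K T.+1)%:E + c%:E))%E).
  apply: ge0_le_integral => //.
  - move=> w _; rewrite lee_fin big_nat_cond sumr_ge0// => t /andP[tT _].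
    by case: (meta_lossE w tT) => _ /andP[].
  - exact/measurable_EFinP.
  - by apply: emeasurable_funD => //; apply: measurable_funeM;
    exact/measurable_EFinP.
  - by move=> w _; rewrite -EFinM -EFinD lee_fin.
rewrite ge0_integralD//; last 2 first.
- by move=> w _; rewrite mule_ge0// lee_fin.
- by apply: measurable_funeM; exact/measurable_EFinP.
rewrite integral_cst// [X in (_ + _ * X)%E]probability_setT mule1.
rewrite ge0_integralZl_EFin//; last 2 first.
- by move=> w _; rewrite lee_fin.
- exact/measurable_EFinP.
rewrite EFinD EFinM leeD2r// lee_wpmul2l ?lee_fin//.
pose f t w := if `[< (1 <= t <=
  T)%N >] then fpl_loss n k s eta (q ^~ w) K t else 0.
have mf t : measurable_fun setT (EFin \o f t).
  apply/measurable_EFinP; rewrite /f; case: asboolP => // _.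
  exact: (measurable_fpl_loss (x := fun i w => q i w) (fun i _ => mq i)).
have f0 t w : (0 <= (f t w)%:E)%E.
  rewrite /f; case: asboolP => // tT; rewrite lee_fin.
  by case/andP: (fpl_loss01 (q ^~ w) K tT).
have fE t w : (1 <= t <= T)%N -> f t w = fpl_loss n k s eta (q ^~ w) K t.
  by move=> tT; rewrite /f asboolT.
under eq_integral => w _.
  rewrite /fpl_past_loss -sumEFin.
  rewrite (eq_big_nat _ _ (F2 := fun t => (f t w)%:E)); last first.
    by move=> t tT; rewrite fE.
  over.
rewrite ge0_integral_sum// /fpl_past_expected_loss -sumEFin.
rewrite (eq_big_nat _ _ (F2 := fun t =>
  (fine 'E_P[fun w => fpl_loss n k s eta (q ^~ w) K t])%:E))// => t tT.
rewrite -/(class_loss K t) (class_lossE K tT).1 expectationE.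
by apply: eq_integral => w _; rewrite fE.
Qed.

(** Jensen for the square root, through the affine majorant with parameter [a = sqrt L + 1]. The
    [+ 1] keeps [a] positive when [L = 0]; it costs [be / 2], absorbed by the second [be]. *)
Lemma meta_jensen K be L : 0 <= be ->
  L = fpl_past_expected_loss n k s q eta K T.+1 ->
  (forall w S, S = fpl_past_loss n k s eta (q ^~ w) K T.+1 ->
     \sum_(1 <= t < T.+1) meta_loss t w <=
       S + be * Num.sqrt S + be ^+ 2 + be) ->
  (hfpl_expected_loss n k s q qt eta etat T <=
    (L + be * Num.sqrt L + be ^+ 2 + 2 * be)%:E)%E.
Proof.
move=> be0 LE le; have L0 : 0 <= L.
  rewrite LE /fpl_past_expected_loss; apply: (sum_nat1_ge0 (leqnn T)) => t tT.
  by have [_ /andP[]] := class_lossE K tT.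
pose a := Num.sqrt L + 1; have r0 := sqrtr_ge0 L; have rE := sqr_sqrtr L0.
have a0 : 0 < a by rewrite /a; lra.
have b1 : 0 <= 1 + be / (2 * a).
  by rewrite addr_ge0// divr_ge0// mulr_ge0// ltW.
have c0 : 0 <= be * a / 2 + be ^+ 2 + be.
  have : 0 <= be * a by rewrite mulr_ge0// ltW.
  have : 0 <= be ^+ 2 by exact: sqr_ge0.
  lra.
apply: le_trans (hfpl_expected_loss_le (K := K) b1 c0 _) _ => [w|].
  apply: le_trans (le w _ erefl) _ => /=.
  have := @fpl_past_loss_ge0 (q ^~ w) K T.+1 (leqnn _).
  move: (fpl_past_loss _ _ _ _ _ _ _) => S S0; have SE := sqr_sqrtr S0.
  (* [2 a sqrt S <= S + a^2] *)
  have : Num.sqrt S <= S / (2 * a) + a / 2.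
    have -> : S / (2 * a) + a / 2 = (S + a ^+ 2) / (2 * a).
      by field; rewrite gt_eqF.
    rewrite ler_pdivlMr ?mulr_gt0//; have := sqr_ge0 (Num.sqrt S - a).
    nra.
  move/(ler_wpM2l be0).
  have -> : (1 + be / (2 * a)) * S = S + be * (S / (2 * a)).
    by field; rewrite gt_eqF.
  lra.
rewrite lee_fin -LE.
have : L / (2 * a) <= Num.sqrt L / 2.
  rewrite ler_pdivrMr ?mulr_gt0//.
  have -> : Num.sqrt L / 2 * (2 * a) = Num.sqrt L * a by field.
  by rewrite /a; nra.
move/(ler_wpM2l be0).
have -> : (1 + be / (2 * a)) * L = L + be * (L / (2 * a)).
  by field; rewrite gt_eqF.
by rewrite /a; lra.
Qed.

End MeasurableRates.

(** Positivity of [k i] makes the ceiling at least 1; complexity 0 is left to [single_expert]. *)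
Lemma expert_class i : experts n i -> 0 < k i ->
  exists K, [/\ (1 <= K)%N, complexity_class n k K i & K%:R <= k i + 1].
Proof.
move=> ni ki; have c0 : 0 < Num.ceil (k i) by rewrite ceil_gt0.
have cE : Num.ceil (k i) = `|Num.ceil (k i)|%N%:Z by rewrite gez0_abs// ltW.
exists `|Num.ceil (k i)|%N; split => //; first by rewrite absz_gt0 gt_eqF.
by have := ceilB1_lt (k i); rewrite {1}cE intrB ltrBlDr => /ltW.
Qed.

Lemma past_loss_ge0 i t : experts n i -> (t <= T.+1)%N -> 0 <= past_loss s i t.
Proof.
case: t => [|t] ni tT; first by rewrite /past_loss big_geq.
by apply: (sum_nat1_ge0 (T := T)) => // j jT; have /andP[] := s01 jT ni.
Qed.

Lemma active_of_class K i : (1 <= K)%N -> complexity_class n k K i ->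
  active_classes n k K.
Proof. by move=> K1 Ki; split => //; exists i. Qed.

(** Common end of (b1) and (b2): [G] is 1 in the former and [1 + ln (1 + s0)] in the latter. The 42
    stems from (b1), where [B <= 6 * sqrt K] bounds [B ^ 2 + B] by [42 * K]. *)
Lemma hierarchical_bound K i G be s0 :
  (1 <= K)%N -> complexity_class n k K i -> K%:R <= k i + 1 -> 0 < k i ->
  1 <= G ->
  (forall t, (1 <= t <= T)%N ->
     measurable_fun setT (fun w : sigma_of lower_index X => (etat t w)^-1)) ->
  be = 15 + 4 * ln K%:R -> s0 = past_loss s i T.+1 ->
  (forall w S, S = fpl_past_loss n k s eta (q ^~ w) K T.+1 ->
     \sum_(1 <= t < T.+1) meta_loss t w <=
       S + be * Num.sqrt S + be ^+ 2 + be) ->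
  (fpl_past_expected_loss n k s q eta K T.+1 <=
     s0 + 2 * Num.sqrt 2 * Num.sqrt K%:R * Num.sqrt s0 + 3 * Num.sqrt s0 +
     42 * K%:R * G) ->
  (hfpl_expected_loss n k s q qt eta etat T <=
    (past_loss s i T.+1 +
     2 * Num.sqrt (2 * past_loss s i T.+1 * k i) * (1 + envelope (k i)) +
     1000 * (k i + 1) * G)%:E)%E.
Proof.
move=> K1 Ki Kk ki G1 me beE sE upper lower.
have K1' : 1 <= K%:R :> R by rewrite ler1n.
have bb := meta_weight_bound K1'; rewrite -beE in bb; have /andP[be0 _] := bb.
apply: le_trans (meta_jensen me be0 erefl upper) _; rewrite lee_fin.
have s00 : 0 <= s0 by rewrite sE; apply: past_loss_ge0 => //;
  exact: class_experts Ki.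
have L0 : 0 <= fpl_past_expected_loss n k s q eta K T.+1.
  apply: (sum_nat1_ge0 (leqnn T)) => t tT.
  by have [_ /andP[]] := class_lossE K tT.
apply: le_trans (combine_levels K1' G1 s00 L0 bb lower) _.
have := envelope_bound K1' Kk ki s00.
have : K%:R * G <= (k i + 1) * G by apply: ler_wpM2r => //; lra.
rewrite beE -sE; lra.
Qed.

Lemma static_bound i :
  (forall K t, (1 <= K)%N -> (1 <= t <= T)%N ->
     eta K t = Num.sqrt (K%:R / (2 * t%:R))) ->
  (forall t w, (1 <= t <= T)%N -> etat t w = 1 / Num.sqrt t%:R) ->
  experts n i -> 0 < k i ->
  (hfpl_expected_loss n k s q qt eta etat T <=
    (past_loss s i T.+1
     + 2 * Num.sqrt (2 * T%:R * k i) * (1 + envelope (k i)))%:E)%E.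
Proof.
move=> etaE etatE ni ki; have [K [K1 Ki Kk]] := expert_class ni ki.
have TT : (1 <= T <= T)%N by rewrite T1 leqnn.
have t0 t : (1 <= t)%N -> 0 < t%:R :> R by move=> t1; rewrite ltr0n.
have K1' : 1 <= K%:R :> R by rewrite ler1n.
have me t : (1 <= t <= T)%N ->
    measurable_fun setT (fun w : sigma_of lower_index X => (etat t w)^-1).
  move=> tT; rewrite (_ : (fun w => _) = cst (1 / Num.sqrt t%:R)^-1) //.
  by apply/funext => w; rewrite etatE.
have mc := meta_complexity_ge (R := R) K1.
(* The 4 is 2 from the expected excess plus 2 from [sum_inv_sqrt]. The bound is affine in the past
   loss with slope 1, so no Jensen step is needed. *)
have upper w : \sum_(1 <= t < T.+1) meta_loss t w <=
    1 * fpl_past_loss n k s eta (q ^~ w) K T.+1 +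
    (meta_complexity K + 4) * Num.sqrt T%:R.
  have := @meta_regret w K T (active_of_class K1 Ki) TT.
  rewrite etatE// invfM invr1 invrK mul1r => reg.
  have {}reg : \sum_(1 <= t < T.+1) (1 - etat t w) * meta_loss t w <=
      fpl_past_loss n k s eta (q ^~ w) K T.+1 +
      (meta_complexity K + 2) * Num.sqrt T%:R.
    apply: reg => t tT.
      by rewrite etatE// mul1r invr_gt0 sqrtr_gt0 t0//; case/andP: tT.
    move: tT => /andP[t1 tT]; have tT' : (1 <= t <= T)%N by rewrite t1 ltnW.
    rewrite (etatE _ _ tT') (etatE t.+1 _ tT) !mul1r.
    by rewrite lef_pV2 ?posrE ?sqrtr_gt0 ?t0// ler_wsqrtr// ler_nat.
  have : \sum_(1 <= t < T.+1) meta_loss t w <=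
      \sum_(1 <= t < T.+1) (1 - etat t w) * meta_loss t w +
      \sum_(1 <= t < T.+1) (Num.sqrt t%:R)^-1.
    rewrite -big_split /=; apply: ler_sum_nat => t tT; rewrite etatE// mul1r.
    have [_ /andP[l0 l1]] := meta_lossE w tT.
    have : 0 <= (Num.sqrt t%:R)^-1 :> R by rewrite invr_ge0 sqrtr_ge0.
    nra.
  have := @sum_inv_sqrt R T; lra.
have c0 : 0 <= (meta_complexity K + 4) * Num.sqrt T%:R :> R.
  by rewrite mulr_ge0 ?sqrtr_ge0//; lra.
apply: le_trans (hfpl_expected_loss_le me ler01 c0 upper) _;
  rewrite lee_fin mul1r.
have y0 := sqrtr_ge0 (T%:R : R).
have rK : Num.sqrt K%:R ^+ 2 = K%:R :> R by rewrite sqr_sqrtr.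
have r1 : 1 <= Num.sqrt K%:R :> R by rewrite -[leLHS]sqrtr1 ler_wsqrtr.
have [s2E s2l s2u] := @sqrt2_bounds R.
(* The leading term has equal halves from [K / eta T] and from the sum of the rates; the last
   summand comes from the excess 2. *)
have lower : fpl_past_expected_loss n k s q eta K T.+1 <=
    past_loss s i T.+1 + 2 * Num.sqrt 2 * Num.sqrt K%:R * Num.sqrt T%:R +
    2 * Num.sqrt 2 * Num.sqrt T%:R.
  have etaE' t : (1 <= t <= T)%N ->
      eta K t = Num.sqrt K%:R / Num.sqrt 2 * (Num.sqrt t%:R)^-1.
    move=> tT; rewrite etaE// sqrtrM// sqrtrV ?mulr_ge0// sqrtrM//.
    by rewrite invfM mulrA.
  have := @class_regret K i T Ki TT; rewrite etaE'// => reg.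
  have {}reg : \sum_(1 <= t < T.+1) (1 - eta K t) * class_loss K t <=
    past_loss s i T.+1 +
    (K%:R + 2) / (Num.sqrt K%:R / Num.sqrt 2 * (Num.sqrt T%:R)^-1).
    apply: reg => t tT.
      rewrite etaE'// mulr_gt0 ?divr_gt0 ?invr_gt0 ?sqrtr_gt0 ?t0//.
      by case/andP: tT.
    move: tT => /andP[t1 tT]; have tT' : (1 <= t <= T)%N by rewrite t1 ltnW.
    rewrite (etaE' _ tT') (etaE' t.+1 tT).
    apply: ler_wpM2l; first by rewrite divr_ge0 ?sqrtr_ge0.
    by rewrite lef_pV2 ?posrE ?sqrtr_gt0 ?t0// ler_wsqrtr// ler_nat.
  have : fpl_past_expected_loss n k s q eta K T.+1 <=
      \sum_(1 <= t < T.+1) (1 - eta K t) * class_loss K t +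
      Num.sqrt K%:R / Num.sqrt 2 * \sum_(1 <= t < T.+1) (Num.sqrt t%:R)^-1.
    rewrite mulr_sumr -big_split /= /fpl_past_expected_loss.
    apply: ler_sum_nat => t tT; rewrite -/(class_loss K t) -etaE'//.
    have [_ /andP[l0 l1]] := class_lossE K tT.
    have : 0 <= eta K t by rewrite etaE// sqrtr_ge0.
    nra.
  have r20 : 0 <= Num.sqrt K%:R / Num.sqrt 2 :> R by rewrite divr_ge0
    ?sqrtr_ge0.
  have := ler_wpM2l r20 (@sum_inv_sqrt R T).
  have -> : Num.sqrt K%:R / Num.sqrt 2 * (2 * Num.sqrt T%:R) =
      Num.sqrt 2 * Num.sqrt K%:R * Num.sqrt T%:R :> R.
    by rewrite -{2}s2E; field; rewrite gt_eqF//; lra.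
  have T0 : 0 < Num.sqrt T%:R :> R by rewrite sqrtr_gt0 t0.
  have : (K%:R + 2) / (Num.sqrt K%:R / Num.sqrt 2 * (Num.sqrt T%:R)^-1) <=
     Num.sqrt 2 * Num.sqrt K%:R * Num.sqrt T%:R + 2 * Num.sqrt 2 * Num.sqrt
       T%:R :> R.
    have -> : (K%:R + 2) / (Num.sqrt K%:R / Num.sqrt 2 * (Num.sqrt T%:R)^-1) =
      Num.sqrt 2 * Num.sqrt T%:R * ((K%:R + 2) / Num.sqrt K%:R) :> R.
      by field; rewrite !gt_eqF//; lra.
    have : (K%:R + 2) / Num.sqrt K%:R <= Num.sqrt K%:R + 2 :> R.
      by rewrite ler_pdivrMr; lra || nra.
    have sT0 : 0 <= Num.sqrt 2 * Num.sqrt T%:R :> R by rewrite mulr_ge0//; lra.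
    by move/(ler_wpM2l sT0); lra.
  lra.
have := envelope_bound K1' Kk ki (ler0n R T).
have l0 : 0 <= ln K%:R :> R by exact: ln_ge0.
move: lower; rewrite /meta_complexity.
have : 0 <= ln K%:R * Num.sqrt T%:R :> R by rewrite mulr_ge0.
have : Num.sqrt 2 * Num.sqrt T%:R <=
  3 / 2 * Num.sqrt T%:R :> R by exact: ler_wpM2r.
lra.
Qed.

Lemma adaptive_bound i :
  (forall t w, (1 <= t <= T)%N -> etat t w = 1 / Num.sqrt
     (2 * (meta_past_expected_loss n k s q qt eta etat t w + 1))) ->
  (forall K t, (1 <= K)%N -> (1 <= t <= T)%N -> eta K t = Num.sqrt
     (K%:R / (2 * (fpl_past_expected_loss n k s q eta K t + 1)))) ->
  experts n i -> 0 < k i ->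
  (hfpl_expected_loss n k s q qt eta etat T <=
    (past_loss s i T.+1 +
     2 * Num.sqrt (2 * past_loss s i T.+1 * k i) * (1 + envelope (k i)) +
     1000 * (k i + 1))%:E)%E.
Proof.
move=> etatE etaE ni ki; have [K [K1 Ki Kk]] := expert_class ni ki.
have TT : (1 <= T <= T)%N by rewrite T1 leqnn.
have K1' : 1 <= K%:R :> R by rewrite ler1n.
have mc := meta_complexity_ge (R := R) K1.
have l0 : 0 <= ln K%:R :> R by exact: ln_ge0.
have [s2E s2l s2u] := @sqrt2_bounds R.
have ml01 w t : (1 <= t <= T)%N -> 0 <= meta_loss t w <= 1.
  by move=> tT; have [] := meta_lossE w tT.
have cl01 t : (1 <= t <= T)%N -> 0 <= class_loss K t <= 1.
  by move=> tT; have [] := class_lossE K tT.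
have etatE' w t : (1 <= t <= T)%N ->
    etat t w = Num.sqrt (1 / 2 / (\sum_(1 <= tau < t) meta_loss tau w + 1)).
  move=> tT; rewrite etatE// -/(meta_loss _ _) !mul1r -invfM sqrtrV//.
  rewrite mulr_ge0// addr_ge0//; case: t tT => // t /andP[_ tT].
  by apply: (sum_nat1_ge0 (ltnW tT)) => j /(ml01 w) /andP[].
have etaE' t : (1 <= t <= T)%N ->
    eta K t = Num.sqrt (K%:R / 2 / (\sum_(1 <= tau < t) class_loss K tau + 1)).
  by move=> tT; rewrite etaE// invfM mulrA.
have rate_pos (c : R) (l : nat -> R) t : 0 < c -> (1 <= t <= T)%N ->
    (forall t, (1 <= t <= T)%N -> 0 <= l t <= 1) ->
    0 < Num.sqrt (c / (\sum_(1 <= tau < t) l tau + 1)).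
  move=> c0 tT l01; rewrite sqrtr_gt0 divr_gt0// ltr_wpDl//.
  case: t tT => // t /andP[_ tT].
  by apply: (sum_nat1_ge0 (ltnW tT)) => j /l01 /andP[].
have rate_noninc (c : R) (l : nat -> R) t : 0 < c -> (1 <= t < T)%N ->
    (forall t, (1 <= t <= T)%N -> 0 <= l t <= 1) ->
    Num.sqrt (c / (\sum_(1 <= tau < t.+1) l tau + 1)) <=
    Num.sqrt (c / (\sum_(1 <= tau < t) l tau + 1)).
  move=> c0 /andP[t1 tT] l01; apply: ler_wsqrtr; apply: ler_wpM2l;
    first exact: ltW.
  have tT' : (1 <= t <= T)%N by rewrite t1 ltnW.
  have S0 : 0 <= \sum_(1 <= tau < t) l tau.
    case: t tT' {t1 tT} => // t /andP[_ tT].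
    by apply: (sum_nat1_ge0 (ltnW tT)) => j /l01 /andP[].
  have /andP[lt0 _] := l01 _ tT'.
  by rewrite big_nat_recr//= lef_pV2 ?posrE; lra.
(* Strong induction on the time: the rate at [t] is a function of the meta losses before [t],
   measurable for [q] as soon as the earlier rates are. *)
have me t : (1 <= t <= T)%N ->
    measurable_fun setT (fun w : sigma_of lower_index X => (etat t w)^-1).
  elim/ltn_ind: t => t IH tT.
  rewrite (_ : (fun w => _) = (fun w : sigma_of lower_index X => Num.sqrt
      (2 * (\sum_(1 <= tau < t) meta_loss tau w + 1)))); last first.
    by apply/funext => w; rewrite etatE// mul1r invrK.
  apply: measurableT_comp.
    by apply: nondecreasing_measurable => // a b; exact: ler_wsqrtr.
  apply: measurable_funM => //; apply: measurable_funD => //.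
  rewrite (_ : (fun w => _) = (fun w : sigma_of lower_index X =>
    \sum_(1 <= tau < t)
      if `[< (1 <= tau < t)%N >] then meta_loss tau w else 0)); last first.
    by apply/funext => w; apply: eq_big_nat => tau tt; rewrite asboolT.
  apply: measurable_sum => tau; case: asboolP => // /andP[tau1 taut].
  have tauT : (1 <= tau <= T)%N.
    by rewrite tau1 (leq_trans (ltnW taut))//; case/andP: tT.
  exact: (measurable_meta_loss tauT (IH _ taut tauT)).
have half : 0 < 1 / 2 :> R by lra.
have K2 : 0 < K%:R / 2 :> R by lra.
rewrite -[X in _ + X]mulr1.
apply: (hierarchical_bound K1 Ki Kk ki (lexx 1) me erefl erefl).
- move=> w S SE.
  have S0 : 0 <= S by rewrite SE;
    exact: (fpl_past_loss_ge0 (q ^~ w) K (leqnn _)).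
  have := @meta_regret w K T (active_of_class K1 Ki) TT.
  rewrite -SE => reg.
  pose B : R := (meta_complexity K + 2) / Num.sqrt (1 / 2) + 2 * Num.sqrt (1 /
    2).
  have := @adaptive_regret _ (meta_loss ^~ w) (etat ^~ w) (1 / 2)
    (meta_complexity K + 2) S B T T1 (ml01 w) half _ S0 (etatE' w) _ erefl.
  have hs : Num.sqrt (1 / 2) = (Num.sqrt 2)^-1 :> R by rewrite mul1r sqrtrV.
  have BE : B = (meta_complexity K + 3) * Num.sqrt 2.
    rewrite /B hs invrK.
    have -> : 2 / Num.sqrt 2 = Num.sqrt 2 :> R.
      by rewrite -{1}s2E; field; rewrite gt_eqF//; lra.
    ring.
  have B0 : 0 <= B by rewrite BE mulr_ge0//; lra.
  have Bb : B <= 15 + 4 * ln K%:R.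
    have : (meta_complexity K + 3) * Num.sqrt 2 <=
      (meta_complexity K + 3) * (3 / 2) :> R.
      by apply: ler_wpM2l => //; lra.
    rewrite BE /meta_complexity; lra.
  move=> /(_ _ _)/le_trans; apply.
  + lra.
  + apply: reg => t tT; first by rewrite etatE'//;
    exact: (rate_pos _ (meta_loss ^~ w) _ half tT (ml01 w)).
    move: (tT) => /andP[t1 tT1]; have tT' : (1 <= t <= T)%N by rewrite t1 ltnW.
    by rewrite (etatE' _ _ tT') (etatE' _ t.+1 tT1);
      exact: (rate_noninc _ (meta_loss ^~ w) _ half tT (ml01 w)).
  + have := ler_wpM2r (sqrtr_ge0 S) Bb.
    have : B ^+ 2 <= (15 + 4 * ln K%:R) ^+ 2 by rewrite ler_sqr ?nnegrE; lra.
    lra.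
- set s0 := past_loss s i T.+1.
  have s00 : 0 <= s0 by exact: past_loss_ge0.
  have y0 := sqrtr_ge0 s0.
  pose B : R := (K%:R + 2) / Num.sqrt (K%:R / 2) + 2 * Num.sqrt (K%:R / 2).
  have := @adaptive_regret _ (class_loss K) (eta K) (K%:R / 2)
    (K%:R + 2) s0 B T T1 cl01 K2 _ s00 etaE' _ erefl.
  have rK : Num.sqrt K%:R ^+ 2 = K%:R :> R by rewrite sqr_sqrtr.
  have r1 : 1 <= Num.sqrt K%:R :> R by rewrite -[leLHS]sqrtr1 ler_wsqrtr.
  have BE : B = 2 * Num.sqrt 2 * Num.sqrt K%:R + 2 * Num.sqrt 2 / Num.sqrt K%:R.
    rewrite /B sqrtrM// sqrtrV// -{1}rK.
    rewrite [X in _ + X = _](_ : _ = Num.sqrt 2 * Num.sqrt K%:R).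
      by field; rewrite !gt_eqF//; lra.
    by rewrite -{1}s2E; field; rewrite gt_eqF//; lra.
  (* The excess 2 contributes [2 * sqrt 2 / sqrt K <= 3], the source of [3 * sqrt s0]. *)
  have Bb : B <= 2 * Num.sqrt 2 * Num.sqrt K%:R + 3.
    rewrite BE lerD2l ler_pdivrMr; lra.
  have B0 : 0 <= B by rewrite BE addr_ge0 ?divr_ge0 ?mulr_ge0//; lra.
  have B6 : B <= 6 * Num.sqrt K%:R by nra.
  move=> /(_ _ _)/le_trans; apply.
  + lra.
  + apply: (class_regret Ki TT) => t tT; first by rewrite etaE'//;
    exact: (rate_pos _ (class_loss K) _ K2 tT cl01).
    move: (tT) => /andP[t1 tT1]; have tT' : (1 <= t <= T)%N by rewrite t1 ltnW.
    by rewrite (etaE' _ tT') (etaE' t.+1 tT1);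
      exact: (rate_noninc _ (class_loss K) _ K2 tT cl01).
  + have := ler_wpM2r y0 Bb.
    have : B ^+ 2 <= 36 * K%:R.
      have : B ^+ 2 <= (6 * Num.sqrt K%:R) ^+ 2 by rewrite ler_sqr ?nnegrE; lra.
      by rewrite exprMn rK; lra.
    have : Num.sqrt K%:R <= K%:R :> R by nra.
    lra.
Qed.

(** * Minimal losses and minimal scales, which define the rates of (b2) *)

Section ClassMinimum.
Variables (K i : nat).
Hypothesis Ki : complexity_class n k K i.
Let m t : R := class_min_past_loss n k s K t.

Lemma class_min_le j t : (t <= T.+1)%N -> complexity_class n k K j ->
  m t <= past_loss s j t.
Proof.
move=> tT Kj; apply: ge_inf; last by exists j.
by exists 0 => _ [l Kl <-]; apply: past_loss_ge0 => //; exact: class_experts Kl.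
Qed.

Lemma le_class_min (a : R) t :
  (forall j, complexity_class n k K j -> a <= past_loss s j t) -> a <= m t.
Proof.
move=> h; apply: lb_le_inf; first by exists (past_loss s i t), i.
by move=> _ [j Kj <-]; exact: h.
Qed.

Lemma class_min1 : m 1%N = 0.
Proof.
apply/eqP; rewrite eq_le; apply/andP; split.
  by apply: le_trans (class_min_le _ Ki) _ => //; rewrite /past_loss big_geq.
by apply: le_class_min => j _; rewrite /past_loss big_geq.
Qed.

Lemma class_minS t : (1 <= t <= T)%N -> m t <= m t.+1 <= m t + 1.
Proof.
move=> /[dup] tT /andP[t1 tT'].
have st j : complexity_class n k K j ->
    past_loss s j t <= past_loss s j t.+1 <= past_loss s j t + 1.
  move=> /class_experts nj; rewrite past_lossS//; have := s01 tT nj; lra.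
apply/andP; split.
  apply: le_class_min => j Kj; apply: le_trans (class_min_le _ Kj) _.
    exact: leqW.
  by case/andP: (st j Kj).
rewrite -lerBlDr; apply: le_class_min => j Kj.
have := class_min_le (t := t.+1) tT' Kj; have := st j Kj; lra.
Qed.

Lemma class_min_ge0 t : (t <= T.+1)%N -> 0 <= m t.
Proof.
by move=> tT; apply: le_class_min => j /class_experts nj; exact: past_loss_ge0.
Qed.

End ClassMinimum.

Let scale (w : Omega) K t : R := meta_complexity K + Num.sqrt
  (meta_complexity K ^+ 2 + 2 * fpl_past_loss n k s eta (q ^~ w) K t + 2).

Section MetaScale.
Variables (w : Omega) (K0 : nat).
Hypothesis aK0 : active_classes n k K0.
Let c t : R := meta_min_scale n k s eta (q ^~ w) t.
Let h := scale w.

(** As [meta_complexity] is at least 1/2, the root is at least [sqrt (1 / 4 + 2) = 3 / 2]. The bound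
    2 is what [meta_self_confident] requires. *)
Let h_ge2 K t : (t <= T.+1)%N -> active_classes n k K -> 2 <= h K t.
Proof.
move=> tT [K1 _]; rewrite /h /scale.
have := meta_complexity_ge (R := R) K1.
have := @fpl_past_loss_ge0 (q ^~ w) K t tT.
move: (fpl_past_loss _ _ _ _ _ _ _) (meta_complexity K) => S x S0 x12.
have e : Num.sqrt ((3 / 2) ^+ 2) = 3 / 2 :> R.
  by rewrite sqrtr_sqr ger0_norm// divr_ge0.
have : 3 / 2 <= Num.sqrt (x ^+ 2 + 2 * S + 2) by rewrite -e; apply: ler_wsqrtr;
  nra.
lra.
Qed.

Lemma meta_scale_le K t : (t <= T.+1)%N -> active_classes n k K -> c t <= h K t.
Proof.
move=> tT aK; apply: ge_inf; last by exists K.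
by exists 2 => _ [l al <-]; exact: h_ge2.
Qed.

Lemma le_meta_scale (a : R) t :
  (forall K, active_classes n k K -> a <= h K t) -> a <= c t.
Proof.
move=> ha; apply: lb_le_inf; first by exists (h K0 t), K0.
by move=> _ [K aK <-]; exact: ha.
Qed.

Lemma meta_scale_ge2 t : (t <= T.+1)%N -> 2 <= c t.
Proof. by move=> tT; apply: le_meta_scale => K aK; exact: h_ge2. Qed.

(** With [r >= 1] the root, one more loss adds at most 2 to its square, and
    [(r + 1)^2 >= r^2 + 2]. *)
Let hS K t : (1 <= t <= T)%N -> active_classes n k K ->
  h K t <= h K t.+1 <= h K t + 1.
Proof.
move=> /[dup] tT /andP[t1 tT'] [K1 _]; rewrite /h /scale.
have S0 := @fpl_past_loss_ge0 (q ^~ w) K t (leqW tT').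
have -> : fpl_past_loss n k s eta (q ^~ w) K t.+1 =
    fpl_past_loss n k s eta (q ^~ w) K t + fpl_loss n k s eta (q ^~ w) K t.
  by rewrite /fpl_past_loss big_nat_recr.
have /andP[l0 l1] := @fpl_loss01 (q ^~ w) K t tT.
move: (fpl_past_loss _ _ _ _ _ _ _) (fpl_loss _ _ _ _ _ _ _) S0 l0 l1 =>
  S l S0 l0 l1.
have := meta_complexity_ge (R := R) K1; move: (meta_complexity K) => x x12.
apply/andP; split; first by rewrite lerD2l; apply: ler_wsqrtr; lra.
have D1 : 1 <= x ^+ 2 + 2 * S + 2 by nra.
have D0 : 0 <= x ^+ 2 + 2 * S + 2 by lra.
have r1 : 1 <= Num.sqrt (x ^+ 2 + 2 * S + 2) by rewrite -[leLHS]sqrtr1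
  ler_wsqrtr.
have rE := sqr_sqrtr D0.
set r := Num.sqrt (x ^+ 2 + 2 * S + 2) in r1 rE *.
have e : Num.sqrt ((r + 1) ^+ 2) = r + 1 by rewrite sqrtr_sqr ger0_norm//; lra.
have : Num.sqrt (x ^+ 2 + 2 * (S + l) + 2) <= r + 1.
  by rewrite -e; apply: ler_wsqrtr; lra.
lra.
Qed.

Lemma meta_scaleS t : (1 <= t <= T)%N -> c t <= c t.+1 <= c t + 1.
Proof.
move=> /[dup] tT /andP[t1 tT']; apply/andP; split.
  apply: le_meta_scale => K aK; apply: le_trans (meta_scale_le _ aK) _.
    exact: leqW.
  by case/andP: (hS tT aK).
rewrite -lerBlDr; apply: le_meta_scale => K aK.
have := meta_scale_le (t := t.+1) tT' aK; have := hS tT aK; lra.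
Qed.

(* The scale [h] of a class solves [h^2 - 2 k h = 2 S + 2], so that the
   minimal scale controls [min_K (S + k h)]. *)
Lemma meta_scale_attained t : (t <= T.+1)%N -> exists2 K, active_classes n k K &
  fpl_past_loss n k s eta (q ^~ w) K t + meta_complexity K * c t <=
    c t ^+ 2 / 2.
Proof.
move=> tT; have c2 := meta_scale_ge2 tT.
(* A class within [1 / (2 c)] of the infimum suffices: the slack raises [c^2] by less than 2, and
   the [+ 2] under the root of the scale compensates this. *)
have e0 : 0 < 1 / (2 * c t) by rewrite divr_gt0//; lra.
have hinf : has_inf [set h K t | K in active_classes n k].
  split; first by exists (h K0 t), K0.
  by exists 2 => _ [l al <-]; exact: h_ge2.
have [_ [K aK <-] hK] := inf_adherent e0 hinf.
exists K => //; have ch := meta_scale_le tT aK; have [K1 _] := aK.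
have := meta_complexity_ge (R := R) K1.
have {}hK : h K t < c t + 1 / (2 * c t) by exact: hK.
have S0 := @fpl_past_loss_ge0 (q ^~ w) K t tT.
move: hK ch; rewrite /h /scale.
move: (fpl_past_loss _ _ _ _ _ _ _) (meta_complexity K) S0 => S x S0 hK ch x12.
have D0 : 0 <= x ^+ 2 + 2 * S + 2 by nra.
have := sqr_sqrtr D0; move: hK ch; set r := Num.sqrt _ => hK ch rE.
have e1 : 1 / (2 * c t) <= 1 / 4 by rewrite ler_pdivrMr; lra.
have e2 : c t * (1 / (2 * c t)) = 1 / 2 by field; rewrite gt_eqF//; lra.
have : (x + r) ^+ 2 <= c t ^+ 2 + 2.
  have : (x + r) ^+ 2 <= (c t + 1 / (2 * c t)) ^+ 2 by rewrite ler_sqr ?nnegrE;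
    lra.
  move: (1 / (2 * c t)) e0 e1 e2 => e e0 e1 e2; nra.
have : x * c t <= x * (x + r) by apply: ler_wpM2l; lra.
lra.
Qed.

End MetaScale.

Lemma self_confident_bound i :
  (forall t w, (1 <= t <= T)%N ->
     etat t w = 1 / meta_min_scale n k s eta (q ^~ w) t) ->
  (forall K t, (1 <= K)%N -> (1 <= t <= T)%N ->
     eta K t = Num.sqrt (1 / 2) *
       (if class_min_past_loss n k s K t == 0 then 1
        else Num.min 1 (Num.sqrt (K%:R / class_min_past_loss n k s K t)))) ->
  experts n i -> 0 < k i ->
  (hfpl_expected_loss n k s q qt eta etat T <=
    (past_loss s i T.+1 +
     2 * Num.sqrt (2 * past_loss s i T.+1 * k i) * (1 + envelope (k i)) +
     1000 * (k i + 1) * (1 + ln (1 + past_loss s i T.+1)))%:E)%E.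
Proof.
move=> etatE etaE ni ki; have [K [K1 Ki Kk]] := expert_class ni ki.
have aK := active_of_class K1 Ki.
have TT : (1 <= T <= T)%N by rewrite T1 leqnn.
have K1' : 1 <= K%:R :> R by rewrite ler1n.
have mc := meta_complexity_ge (R := R) K1.
have l0 : 0 <= ln K%:R :> R by exact: ln_ge0.
set s0 := past_loss s i T.+1.
have s00 : 0 <= s0 by exact: past_loss_ge0.
have G1 : 1 <= 1 + ln (1 + s0) by rewrite lerDl ln_ge0//; lra.
have me t : (1 <= t <= T)%N ->
    measurable_fun setT (fun w : sigma_of lower_index X => (etat t w)^-1).
  move=> tT; rewrite (_ : (fun w => _) = (fun w : sigma_of lower_index X =>
      meta_min_scale n k s eta (q ^~ w) t)); last first.
    by apply/funext => w; rewrite etatE// mul1r invrK.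
  have mx j : experts n j ->
    measurable_fun setT (q j : sigma_of lower_index X -> R).
    by move=> nj; apply: (@measurable_fun_coord _ _ _ _ _ lower_index X (inl
      j)).
  by apply: (measurable_meta_min_scale (x :=
    fun j (w : sigma_of lower_index X) => q j w)
    mx t); exists K.
apply: (hierarchical_bound K1 Ki Kk ki G1 me erefl erefl).
- move=> w S SE; pose c t : R := meta_min_scale n k s eta (q ^~ w) t.
  have S0 : 0 <= S by rewrite SE;
    exact: (fpl_past_loss_ge0 (q ^~ w) K (leqnn _)).
  have etatE' t : (1 <= t <= T)%N -> etat t w = (c t)^-1.
    by move=> tT; rewrite etatE// mul1r.
  have c2 t : (1 <= t <= T.+1)%N -> 2 <= c t.
    by move=> /andP[_ tT]; exact: (meta_scale_ge2 w aK).
  have cS t : (1 <= t <= T)%N -> c t <= c t.+1 <= c t + 1.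
    exact: (meta_scaleS w aK).
  have reg K' tau : active_classes n k K' -> (1 <= tau <= T)%N ->
      \sum_(1 <= t < tau.+1) (1 - (c t)^-1) * meta_loss t w <=
      fpl_past_loss n k s eta (q ^~ w) K' tau.+1 + (meta_complexity K' + 2) * c
        tau.
    move=> aK' tauT; have := @meta_regret w K' tau aK' tauT.
    rewrite etatE'// invrK (eq_big_nat _ _
      (F2 := fun t => (1 - (c t)^-1) * meta_loss t w)); last first.
      move=> t /andP[t1 tt]; rewrite etatE'// t1 (@leq_trans tau)//.
      by case/andP: tauT.
    case/andP: tauT => tau1 tauT; apply => t /andP[t1 tt].
      rewrite etatE' ?t1 ?(leq_trans tt)// invr_gt0.
      by apply: lt_le_trans (c2 _ _) => //; rewrite t1 leqW// (leq_trans tt).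
    have tT' : (1 <= t <= T)%N by rewrite t1 (leq_trans (ltnW tt)).
    have tT'' : (1 <= t.+1 <= T)%N by rewrite (leq_trans tt).
    have := cS t tT'; have := c2 t; rewrite t1 leqW; last by case/andP: tT'.
    move=> /(_ isT) ct /andP[ctS _].
    by rewrite !etatE'// lef_pV2 ?posrE; lra.
  (* At each time [tau] the comparator is a class nearly realizing the minimal scale, so the regret
     bound becomes a function of [c tau.+1] alone. *)
  have rate : \sum_(1 <= t < T.+1) (c t)^-1 * meta_loss t w <= 9 / 2 * c T.+1.
    apply: meta_self_confident => // tau tauT.
    have tau1T : (tau.+1 <= T.+1)%N by case/andP: tauT.
    have [K' aK' hK'] := meta_scale_attained w aK tau1T.
    apply: le_trans (reg K' tau aK' tauT) _.
    have /andP[cc _] := cS tau tauT; have [K1'' _] := aK'.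
    have mc' := meta_complexity_ge (R := R) K1''.
    have mc2 : 0 <= meta_complexity K' + 2 :> R by lra.
    have := ler_wpM2l mc2 cc; rewrite -/(c _) in hK'; lra.
  have : \sum_(1 <= t < T.+1) meta_loss t w =
      \sum_(1 <= t < T.+1) (1 - (c t)^-1) * meta_loss t w +
      \sum_(1 <= t < T.+1) (c t)^-1 * meta_loss t w.
    by rewrite -big_split /=; apply: eq_big_nat => t _; ring.
  move=> ->; apply: le_trans (lerD (reg K T aK TT) rate) _; rewrite -SE.
  have /andP[cT _] := cS T TT.
  have y0 := sqrtr_ge0 S; have yE := sqr_sqrtr S0.
  have cu : c T.+1 <= 2 * (meta_complexity K + Num.sqrt S + 1).
    apply: le_trans (meta_scale_le w (leqnn _) aK) _; rewrite /scale -SE.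
    have -> : 2 * (meta_complexity K + Num.sqrt S + 1) = meta_complexity K +
      Num.sqrt ((meta_complexity K + 2 * Num.sqrt S + 2) ^+ 2).
      by rewrite sqrtr_sqr ger0_norm; lra.
    by rewrite lerD2l; apply: ler_wsqrtr; nra.
  have mc2 : 0 <= meta_complexity K + 2 :> R by lra.
  (* [13 / 2] is the 2 of the expected excess plus the [9 / 2] of [rate]. *)
  have mc6 : 0 <= meta_complexity K + 13 / 2 :> R by lra.
  have h1 := ler_wpM2l mc2 cT; have h2 := ler_wpM2l mc6 cu.
  have be : 15 + 4 * ln K%:R = 2 * meta_complexity K + 14 :> R.
    by rewrite /meta_complexity; lra.
  rewrite be; move: (meta_complexity K) mc h1 h2 {mc2 mc6 be cu} => x mc h1 h2.
  nra.
- rewrite -/s0; pose m t : R := class_min_past_loss n k s K t.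
  pose v t : R := Num.sqrt 2 * Num.max 1 (Num.sqrt (m t / K%:R)).
  have [s2E s2l s2u] := @sqrt2_bounds R.
  have max1 x : 1 <= Num.max 1 x :> R by rewrite le_max lexx.
  have v0 t : 0 < v t by rewrite mulr_gt0// ?(lt_le_trans ltr01)//; lra.
  have etaE' t : (1 <= t <= T)%N -> eta K t = (v t)^-1.
    move=> tT; rewrite etaE// -/(m t) /v invfM mul1r sqrtrV//; congr (_ * _).
    have mt0 : 0 <= m t by apply: (class_min_ge0 Ki); case/andP: tT => _ /leqW.
    (* The convention for a zero minimum agrees with [max 1 (sqrt 0) = 1], so [v] needs no case
       distinction. *)
    case: eqP => [->|/eqP mt]; first by rewrite mul0r sqrtr0 max_l ?invr1.
    have mtp : 0 < m t by rewrite lt_neqAle eq_sym mt.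
    have K0 : 0 < K%:R :> R by lra.
    have -> : Num.sqrt (K%:R / m t) = (Num.sqrt (m t / K%:R))^-1.
      by rewrite -sqrtrV ?divr_ge0// ?ltW// invfM invrK mulrC.
    have z0 : 0 < Num.sqrt (m t / K%:R) by rewrite sqrtr_gt0 divr_gt0.
    have [h|h] := leP 1 (Num.sqrt (m t / K%:R)).
      by rewrite min_r// invf_le1.
    by rewrite min_l ?invr1// invf_ge1// ltW.
  have mS := class_minS Ki.
  have lower : fpl_past_expected_loss n k s q eta K T.+1 <= m T.+1 +
      2 * Num.sqrt 2 * Num.sqrt K%:R * Num.sqrt (m T.+1) + 3 * Num.sqrt (m
        T.+1) +
      18 * K%:R * (1 + ln (1 + m T.+1)).
    apply: (class_self_confident (l := class_loss K) (m := m) (v := v)) => //.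
      exact: class_min1 Ki.
    (* The regret bound holds against every [j] of the class, hence against the minimum that enters
       the rate. *)
    move=> tau tauT; rewrite -lerBlDr; apply: (le_class_min Ki) => j Kj.
    rewrite lerBlDr; have := @class_regret K j tau Kj tauT.
    rewrite etaE'// invrK (eq_big_nat _ _
      (F2 := fun t => (1 - (v t)^-1) * class_loss K t)); last first.
      move=> t /andP[t1 tt]; rewrite etaE'// t1 (@leq_trans tau)//.
      by case/andP: tauT.
    case/andP: tauT => tau1 tauT; apply => t /andP[t1 tt].
      by rewrite etaE' ?t1 ?(leq_trans tt)// invr_gt0.
    have tT' : (1 <= t <= T)%N by rewrite t1 (leq_trans (ltnW tt)).
    have tT'' : (1 <= t.+1 <= T)%N by rewrite (leq_trans tt).
    rewrite !etaE'// lef_pV2 ?posrE//; apply: ler_wpM2l; first lra.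
    rewrite ge_max !le_max lexx /= orbC ler_wsqrtr//.
    by apply: ler_wpM2r; [rewrite invr_ge0|case/andP: (mS t tT')].
  apply: le_trans lower _.
  have ms : m T.+1 <= s0 by exact: (class_min_le (leqnn _) Ki).
  have m0 : 0 <= m T.+1 by exact: (class_min_ge0 Ki).
  have h1 : Num.sqrt (m T.+1) <= Num.sqrt s0 by exact: ler_wsqrtr.
  have h2 : ln (1 + m T.+1) <= ln (1 + s0) by rewrite ler_ln ?posrE; lra.
  have r0 : 0 <= 2 * Num.sqrt 2 * Num.sqrt K%:R :> R.
    by rewrite !mulr_ge0 ?sqrtr_ge0.
  have := ler_wpM2l r0 h1.
  have K18 : 0 <= K%:R :> R by lra.
  have := ler_wpM2l K18 h2.
  have : 0 <= K%:R * (1 + ln (1 + s0)) by rewrite mulr_ge0//; lra.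
  lra.
Qed.

(** Complexity 0 has weight 1 and exhausts the Kraft sum, so [i] is the only expert and equals 1.
    Its ceiling 0 lies in no class, and all selections return the default 1, which is the correct
    prediction. *)
Lemma single_expert i : experts n i -> k i = 0 ->
  hfpl_expected_loss n k s q qt eta etat T = (past_loss s i T.+1)%:E.
Proof.
move=> ni ki0; have only_i j : experts n j -> j = i.
  move=> nj; apply/eqP/negPn/negP => ji.
  have := kraft; have -> : experts n = [set l | l \in experts n].
    by apply/seteqP; split => l; rewrite /= inE.
  rewrite -nneseries_esum; last by move=> l _; rewrite lee_fin expR_ge0.
  rewrite (@nneseriesD1 _ _ i); [|by move=> l _;
    rewrite lee_fin expR_ge0|exact: mem_set].
  rewrite (@nneseriesD1 _ _ j); [|by move=> l _;
    rewrite lee_fin expR_ge0|by rewrite mem_set].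
  rewrite ki0 oppr0 expR0 leNgt => /negP; apply.
  rewrite -[ltLHS]adde0 lteD2lE//.
  apply: (@lt_le_trans _ _ (expR (- k j))%:E);
    first by rewrite lte_fin expR_gt0.
  by apply: leeDl; apply: nneseries_ge0 => l _ _; rewrite lee_fin expR_ge0.
have class0 K : (1 <= K)%N -> complexity_class n k K = set0.
  move=> K1; apply/seteqP; split => // j [/only_i ->].
  by rewrite ki0 ceil0 => -[] e; move: K1; rewrite -e.
have active0 : active_classes n k = set0.
  by apply/seteqP; split => // K [/class0 ->] [].
rewrite /hfpl_expected_loss (_ : (fun w => _) = cst (past_loss s i T.+1)).
  exact: expectation_cst.
apply/funext => w; apply: eq_big_nat => t _.
rewrite /hfpl_select /meta_select active0 argmin_set0.
by rewrite /fpl_select class0// argmin_set0 (only_i _ experts1).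
Qed.

End Hierarchy.

Theorem theorem9 (R : realType) :
  exists (fa fb1 gb1 fb2 : R -> R) (hb2 : R * R -> R),
  [/\ (forall k0 : R, 1 < k0 ->
         bigO_on `[k0, +oo[ fa (fun x => ln x / Num.sqrt x)),
      (forall k0 : R, 1 < k0 ->
         bigO_on `[k0, +oo[ fb1 (fun x => ln x / Num.sqrt x)) /\
      (forall k0 : R, 0 < k0 -> bigO_on `[k0, +oo[ gb1 (fun x => x)),
      (forall k0 : R, 1 < k0 ->
         bigO_on `[k0, +oo[ fb2 (fun x => ln x / Num.sqrt x)) /\
      (forall k0 L0 : R, 0 < k0 -> 1 < L0 ->
         bigO_on (`[k0, +oo[ `*` `[L0, +oo[) hb2
           (fun z => z.1 * ln z.2)) &
  forall (n : option nat) (k : nat -> R) (T : nat) (s : nat -> nat -> R)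
    (d : measure_display) (Omega : measurableType d)
    (P : probability Omega R) (q qt : nat -> {RV P >-> R}),
  n != Some 0%N ->
  (forall i, experts n i -> 0 <= k i) ->
  (\esum_(i in experts n) (expR (- k i))%:E <= 1)%E ->
  (1 <= T)%N ->
  (forall t i, (1 <= t <= T)%N -> experts n i -> 0 <= s t i <= 1) ->
  mutually_independent (perturbation_index n) (perturbations q qt) ->
  (forall j, perturbation_index n j ->
     exponentially_distributed (perturbations q qt j)) ->
  forall (eta : nat -> nat -> R) (etat : nat -> Omega -> R),
  [/\
   (forall K t, (1 <= K)%N -> (1 <= t <= T)%N ->
      eta K t = Num.sqrt (K%:R / (2 * t%:R))) ->
   (forall t w, (1 <= t <= T)%N -> etat t w = 1 / Num.sqrt t%:R) ->
   forall i, experts n i ->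
     (hfpl_expected_loss n k s q qt eta etat T <=
       (past_loss s i T.+1
        + 2 * Num.sqrt (2 * T%:R * k i) * (1 + fa (k i)))%:E)%E,
   (forall t w, (1 <= t <= T)%N ->
      etat t w = 1 / Num.sqrt
        (2 * (meta_past_expected_loss n k s q qt eta etat t w + 1))) ->
   (forall K t, (1 <= K)%N -> (1 <= t <= T)%N ->
      eta K t = Num.sqrt
        (K%:R / (2 * (fpl_past_expected_loss n k s q eta K t + 1)))) ->
   forall i, experts n i ->
     (hfpl_expected_loss n k s q qt eta etat T <=
       (past_loss s i T.+1
        + 2 * Num.sqrt (2 * past_loss s i T.+1 * k i) * (1 + fb1 (k i))
        + gb1 (k i))%:E)%E &
   (forall t w, (1 <= t <= T)%N ->
      etat t w = 1 / meta_min_scale n k s eta (q ^~ w) t) ->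
   (forall K t, (1 <= K)%N -> (1 <= t <= T)%N ->
      eta K t = Num.sqrt (1 / 2) *
        (if class_min_past_loss n k s K t == 0 then 1
         else Num.min 1 (Num.sqrt (K%:R / class_min_past_loss n k s K t)))) ->
   forall i, experts n i ->
     (hfpl_expected_loss n k s q qt eta etat T <=
       (past_loss s i T.+1
        + 2 * Num.sqrt (2 * past_loss s i T.+1 * k i) * (1 + fb2 (k i))
        + hb2 (k i, past_loss s i T.+1))%:E)%E]].
Proof.
(* The error functions are fixed before experts, losses and perturbations, so the O-terms are
   uniform in all of them. *)
exists envelope, envelope, (fun x => 1000 * (x + 1)), envelope,
  (fun z => 1000 * (z.1 + 1) * (1 + ln (1 + z.2))).
split.
- exact: envelope_bigO.
- by split; [exact: envelope_bigO|exact: remainder_bigO].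
- by split; [exact: envelope_bigO|exact: log_remainder_bigO].
move=> n k T s d Omega P q qt n0 k0 kraft T1 s01 ind expq eta etat.
have sum_ge0 i : experts n i -> 0 <= past_loss s i T.+1.
  by move=> ni; exact: (past_loss_ge0 s01 ni (leqnn _)).
have k_pos i : experts n i -> k i != 0 -> 0 < k i.
  by move=> ni ki; rewrite lt_neqAle eq_sym ki k0.
have single i := single_expert T s q qt n0 kraft eta etat (i := i).
split.
(* At complexity 0 the value of [envelope] is irrelevant, being multiplied by the root of 0. *)
- move=> etaE etatE i ni; have [ki0|/(k_pos i ni) ki] := eqVneq (k i) 0.
    by rewrite (single i)// ki0 mulr0 sqrtr0 mulr0 mul0r addr0.
  exact: (static_bound n0 k0 kraft T1 s01 ind expq etaE etatE ni ki).
- move=> etatE etaE i ni; have [ki0|/(k_pos i ni) ki] := eqVneq (k i) 0.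
    rewrite (single i)// lee_fin.
    by rewrite ki0 (mulr0 (2 * past_loss s i T.+1)) sqrtr0; lra.
  exact: (adaptive_bound n0 k0 kraft T1 s01 ind expq etatE etaE ni ki).
- move=> etatE etaE i ni /=; have [ki0|/(k_pos i ni) ki] := eqVneq (k i) 0.
    rewrite (single i)// lee_fin.
    have : 0 <= ln (1 + past_loss s i T.+1) by rewrite ln_ge0// lerDl sum_ge0.
    by rewrite ki0 (mulr0 (2 * past_loss s i T.+1)) sqrtr0; lra.
  exact: (self_confident_bound n0 k0 kraft T1 s01 ind expq etatE etaE ni ki).
Qed.
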